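(* Let $0<\alpha\leq 1$. Suppose that the functions $f\in\mathcal{A}$ and $g\in\mathcal{H}[1,1]$ satisfy $$\left|\operatorname{Im}\left(1+\frac{zf''(z)g(z)+2zf'(z)g'(z)+zg''(z)f(z)}{f'(z)g(z)+g'(z)f(z)}-\left(\frac{zf'(z)}{f(z)}+\frac{zg'(z)}{g(z)}\right)\right)\right|<\alpha\qquad (z\in\mathbb{D}).$$ Then $fg\in\mathcal{S}^*[\alpha]$.
   Context: $\mathbb{D}$ is the open unit disc in $\mathbb{C}$. $\mathcal{H}[1,1]$ is the class of analytic functions $g$ on $\mathbb{D}$ with $g(0)=1$; $\mathcal{A}=\{z\,h(z): h\in\mathcal{H}[1,1]\}$, i.e. analytic functions $f$ on $\mathbb{D}$ with $f(0)=0$, $f'(0)=1$. Quotients with a removable singularity at $z=0$ are interpreted by continuity there. For analytic functions $F,G$ on $\mathbb{D}$, $F\prec G$ ($F$ is subordinate to $G$) means there is an analytic $w:\mathbb{D}\to\mathbb{D}$ with $w(0)=0$ and $F(z)=G(w(z))$ for all $z\in\mathbb{D}$. For $0<\alpha\leq 1$, $\mathcal{S}^*[\alpha]=\left\{f\in\mathcal{A}: \frac{zf'(z)}{f(z)}\prec\left(\frac{1+z}{1-z}\right)^{\alpha}\right\}$ is the class of strongly starlike functions of order $\alpha$, with the principal branch of the power. *)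

(* Defs.v *)
From Stdlib Require Import Reals.
From Coquelicot Require Import Coquelicot.
Open Scope C_scope.

Definition unit_disc (z : C) : Prop := (Cmod z < 1)%R.

(* "Analytic" is complex differentiability at every point of the disc; the
   values of [f] outside the disc are irrelevant. *)
Definition analytic (f : C -> C) : Prop :=
  forall z : C, unit_disc z -> @ex_derive C_AbsRing C_NormedModule f z.

Definition class_H11 (g : C -> C) : Prop := analytic g /\ g 0 = 1.

Definition class_A (f : C -> C) : Prop :=
  analytic f /\ f 0 = 0 /\ C_derive f 0 = 1.

(* The quotient [N / D], with its value at [0] given by continuity.  For
   [z <> 0] it has its meaning only where [D z <> 0]. *)
Definition quot (N D : C -> C) (z : C) : C :=
  if Ceq_dec z 0 then C_lim (fun x => N x / D x) 0 else N z / D z.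

Definition zlogder (f : C -> C) : C -> C :=
  quot (fun z => z * C_derive f z) f.

Definition subordinate (F G : C -> C) : Prop :=
  exists w : C -> C,
    analytic w /\ (forall z : C, unit_disc z -> unit_disc (w z)) /\ w 0 = 0 /\
    (forall z : C, unit_disc z -> F z = G (w z)).

Definition Cexp (z : C) : C := (exp (Re z) * cos (Im z), exp (Re z) * sin (Im z))%R.

(* Principal argument in (-PI, PI], for [z <> 0]. *)
Definition Carg (z : C) : R :=
  if Rle_dec 0 (Im z) then acos (Re z / Cmod z) else (- acos (Re z / Cmod z))%R.

Definition Clog (z : C) : C := (ln (Cmod z), Carg z).

(* Principal branch of [z ^ a], for [z <> 0]. *)
Definition Cpower (z : C) (a : R) : C := Cexp (a * Clog z).

(* Nonvanishing of [f] off the origin is what makes [z f'(z) / f(z)] a function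
   on the whole disc. *)
Definition strongly_starlike (alpha : R) (f : C -> C) : Prop :=
  class_A f /\
  (forall z : C, unit_disc z -> z <> 0 -> f z <> 0) /\
  subordinate (zlogder f) (fun z => Cpower ((1 + z) / (1 - z)) alpha).

(* Main.v *)
(** Put [h = f g]. Since [f z = z k z] with [k] analytic and zero-free, [p = z h'/h] extends to
    the zero-free analytic function [h'/(k g)], with [p 0 = 1], and for [z <> 0] the quantity in
    the hypothesis is [z p'/p]. So [F = z p'/p] satisfies [F 0 = 0] and [|Im F| < alpha], and
    Harnack's inequality for [Re (alpha +- i F)] gives [|Im F (t z)| <= 2 alpha t / (1 + t)].
    If [L] is the logarithm of [p] with [L 0 = 0], then [t d/dt L (t z) = F (t z)], whence
    [|Im L| <= 2 alpha ln 2 < alpha PI / 2]. Thus [exp (L / alpha)] lies in the right half-plane,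
    and [w = (exp (L / alpha) - 1) / (exp (L / alpha) + 1)] realises the subordination.

    Analyticity being bare complex differentiability, differentiating twice requires Cauchy's
    theory: Goursat's theorem on rectangles gives a primitive, which has a continuous derivative;
    for such functions Cauchy's formula on a circle follows by contracting the circle to a point
    and differentiating under the integral sign. *)

Require Import Defs.
From Stdlib Require Import Reals Lra Lia.
From Coquelicot Require Import Coquelicot.
Open Scope C_scope.

(** The bound [|Im F| < alpha] alone would only control the derivative of [Im L] along a ray by
    alpha / t, which is not integrable at t = 0. Harnack repairs this: Re (alpha +- i F) equals
    alpha at 0, so the loss is alpha - alpha (1 - t) / (1 + t) = 2 alpha t / (1 + t), and its factor
    t cancels the 1 / t. The final comparison of 2 ln 2 with PI / 2 is about 1.386 against 1.571, so
    the crude estimates ln 2 < 3/4 and PI > 3 are enough.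

    No boundary behaviour enters: for fixed z in the disc, w -> F (z w) is analytic on a disc of
    radius [R0 > 1]. The integrals over the unit circle therefore lie inside the domain, and the
    direction of z is absorbed in the function, so the Poisson kernel is only used at real points
    t. *)

(** * Complex derivatives and their rules *)

Definition is_Cderive (f : C -> C) (z l : C) : Prop := @is_derive C_AbsRing C_NormedModule f z l.
Definition ex_Cderive (f : C -> C) (z : C) : Prop := @ex_derive C_AbsRing C_NormedModule f z.

Lemma is_Cderive_eps (f : C -> C) (z l : C) :
  is_Cderive f z l <->
  forall eps : R, (0 < eps)%R -> exists d : R, (0 < d)%R /\
    forall y, (Cmod (y - z) < d)%R ->
      (Cmod (f y - f z - l * (y - z)) <= eps * Cmod (y - z))%R.
Proof.
split.
- intros [_ H] eps He.
  destruct (H z (fun P HP => HP) (mkposreal eps He)) as [d Hd].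
  exists d; split; [apply cond_pos|].
  intros y Hy. specialize (Hd y Hy). simpl in Hd.
  rewrite (Cmult_comm l). exact Hd.
- intros H; split.
  + apply is_linear_scal_l.
  + intros x Hx.
    assert (Hz : x = z).
    { symmetry; exact (@is_filter_lim_locally_unique C_AbsRing (AbsRing_NormedModule C_AbsRing) z x Hx). }
    subst x.
    intros eps. destruct (H eps (cond_pos eps)) as [d [d0 Hd]].
    exists (mkposreal d d0). intros y Hy. specialize (Hd y Hy).
    rewrite (Cmult_comm l) in Hd. exact Hd.
Qed.

Lemma is_Cderive_eq (f : C -> C) (z l l' : C) : is_Cderive f z l' -> l' = l -> is_Cderive f z l.
Proof. intros H <-. exact H. Qed.

Lemma is_Cderive_ext_ball (f g : C -> C) (z l : C) (r : R) (r0 : (0 < r)%R)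
  (Hfg : forall y, (Cmod (y - z) < r)%R -> f y = g y) (Hf : is_Cderive f z l) :
  is_Cderive g z l.
Proof.
apply (is_derive_ext_loc f); [|exact Hf].
exists (mkposreal r r0). intros y Hy. apply Hfg, Hy.
Qed.

Lemma is_Cderive_continuous (f : C -> C) (z l : C) : is_Cderive f z l ->
  forall eps : R, (0 < eps)%R -> exists d : R, (0 < d)%R /\
    forall y, (Cmod (y - z) < d)%R -> (Cmod (f y - f z) < eps)%R.
Proof.
intros H eps He.
destruct (proj1 (is_Cderive_eps f z l) H 1 Rlt_0_1) as [d [d0 Hd]].
set (K := (Cmod l + 1)%R).
assert (K0 : (0 < K)%R) by (unfold K; generalize (Cmod_ge_0 l); lra).
exists (Rmin d (eps / K)). split.
{ apply Rmin_case; auto. apply Rdiv_lt_0_compat; auto. }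
intros y Hy.
assert (H1 := Hd y (Rlt_le_trans _ _ _ Hy (Rmin_l _ _))).
assert (H2 := Rlt_le_trans _ _ _ Hy (Rmin_r _ _)).
replace (f y - f z) with ((f y - f z - l * (y - z)) + l * (y - z)) by ring.
eapply Rle_lt_trans. apply Cmod_triangle.
rewrite Cmod_mult.
apply (Rmult_lt_compat_r K) in H2; auto.
replace (eps / K * K)%R with eps in H2 by (field; lra).
unfold K in H2. nra.
Qed.

Lemma is_Cderive_const (c z : C) : is_Cderive (fun _ => c) z 0.
Proof. apply (@is_derive_const C_AbsRing C_NormedModule). Qed.

(* Coquelicot puts two different uniform structures on [C]; its product and identity rules for
   derivatives use the one induced by [C_AbsRing]. *)
Lemma is_Cderive_AbsRing (f : C -> C) (z l : C) :
  is_Cderive f z l <-> @is_derive C_AbsRing (AbsRing_NormedModule C_AbsRing) f z l.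
Proof.
split; intros [H1 H2]; (split; [apply is_linear_scal_l|]); intros x Hx eps;
  exact (H2 x Hx eps).
Qed.

Lemma is_Cderive_id (z : C) : is_Cderive (fun x => x) z 1.
Proof. apply is_Cderive_AbsRing, (@is_derive_id C_AbsRing). Qed.

Lemma is_Cderive_plus (f g : C -> C) (z lf lg : C) :
  is_Cderive f z lf -> is_Cderive g z lg ->
  is_Cderive (fun x => f x + g x) z (lf + lg).
Proof. apply (@is_derive_plus C_AbsRing C_NormedModule). Qed.

Lemma is_Cderive_minus (f g : C -> C) (z lf lg : C) :
  is_Cderive f z lf -> is_Cderive g z lg ->
  is_Cderive (fun x => f x - g x) z (lf - lg).
Proof. apply (@is_derive_minus C_AbsRing C_NormedModule). Qed.

Lemma is_Cderive_mult (f g : C -> C) (z lf lg : C) :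
  is_Cderive f z lf -> is_Cderive g z lg ->
  is_Cderive (fun x => f x * g x) z (lf * g z + f z * lg).
Proof.
intros Hf%is_Cderive_AbsRing Hg%is_Cderive_AbsRing. apply is_Cderive_AbsRing.
apply (@is_derive_mult C_AbsRing f g z lf lg Hf Hg).
exact Cmult_comm.
Qed.
Lemma is_Cderive_comp (f g : C -> C) (z df dg : C) :
  is_Cderive f (g z) df -> is_Cderive g z dg ->
  is_Cderive (fun x => f (g x)) z (dg * df).
Proof.
intros Hf Hg%is_Cderive_AbsRing.
apply (@is_derive_comp C_AbsRing C_NormedModule f g z df dg Hf Hg).
Qed.

Lemma is_Cderive_inv_id (z : C) : z <> 0 -> is_Cderive Cinv z (- / (z * z)).
Proof.
intros Hz. apply is_Cderive_eps. intros eps He.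
assert (m0 : (0 < Cmod z)%R) by (apply Cmod_gt_0; auto).
set (m := Cmod z) in *.
(* The remainder is (y - z)^2 / (z^2 y). The first bound keeps |y| above m / 2; the second then
   makes |y - z| / (m^2 |y|) at most [eps]. *)
exists (Rmin (m / 2) (eps * (m * m * m) / 2))%R. split.
{ apply Rmin_case; [lra|].
  assert (0 < m * m * m)%R by (repeat apply Rmult_lt_0_compat; auto). nra. }
intros y Hy.
assert (H1 := Rlt_le_trans _ _ _ Hy (Rmin_l _ _)).
assert (H2 := Rlt_le_trans _ _ _ Hy (Rmin_r _ _)).
assert (Hm : (m / 2 < Cmod y)%R).
{ assert (T := Cmod_triangle y (z - y)).
  replace (y + (z - y)) with z in T by ring.
  rewrite <- (Cmod_opp (z - y)), Copp_minus_distr in T. fold m in T. lra. }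
assert (Hy0 : y <> 0) by (apply Cmod_gt_0; lra).
replace (/ y - / z - - / (z * z) * (y - z)) with ((y - z) * ((y - z) / (z * z * y)))
  by (field; auto).
rewrite Cmod_mult, (Rmult_comm eps). apply Rmult_le_compat_l; [apply Cmod_ge_0|].
rewrite Cmod_div by (repeat apply Cmult_neq_0; auto).
rewrite !Cmod_mult. fold m.
apply (Rmult_le_reg_r (m * m * Cmod y)).
{ repeat apply Rmult_lt_0_compat; auto; lra. }
unfold Rdiv; rewrite Rmult_assoc, Rinv_l by (repeat apply Rmult_integral_contrapositive_currified; lra).
rewrite Rmult_1_r.
assert (0 < eps * (m * m))%R by (apply Rmult_lt_0_compat; auto; apply Rmult_lt_0_compat; auto).
nra.
Qed.

Lemma is_Cderive_div (f g : C -> C) (z lf lg : C) :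
  is_Cderive f z lf -> is_Cderive g z lg -> g z <> 0 ->
  is_Cderive (fun x => f x / g x) z ((lf * g z - f z * lg) / (g z * g z)).
Proof.
intros Hf Hg H0.
assert (H := is_Cderive_mult f (fun x => / g x) z lf _ Hf
  (is_Cderive_comp Cinv g z _ lg (is_Cderive_inv_id _ H0) Hg)).
replace ((lf * g z - f z * lg) / (g z * g z))
  with (lf * / g z + f z * (lg * - / (g z * g z))) by (field; auto).
exact H.
Qed.

Lemma is_Cderive_unique (f : C -> C) (z l : C) : is_Cderive f z l -> C_derive f z = l.
Proof. apply is_C_derive_unique. Qed.

Lemma Cderive_correct (f : C -> C) (z : C) : ex_Cderive f z -> is_Cderive f z (C_derive f z).
Proof. intros H. apply (C_derive_correct f z z H). Qed.

(** * Integration and differentiation of complex functions of a real variable *)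

Definition CRInt (phi : R -> C) (a b : R) : C := @RInt C_R_CompleteNormedModule phi a b.
Definition ex_CRInt (phi : R -> C) (a b : R) : Prop := @ex_RInt C_R_NormedModule phi a b.
Definition path_derive (phi : R -> C) (t : R) (l : C) : Prop :=
  @is_derive R_AbsRing C_R_NormedModule phi t l.
(** Stated with [Cmod], because the real normed module structure on [C] is that of a product, whose
    balls are squares. *)
Definition path_cont (phi : R -> C) (t : R) : Prop :=
  forall eps : R, (0 < eps)%R -> exists d : R, (0 < d)%R /\
    forall s, (Rabs (s - t) < d)%R -> (Cmod (phi s - phi t) < eps)%R.

Lemma path_cont_continuous (phi : R -> C) (t : R) :
  path_cont phi t -> @continuous R_UniformSpace C_R_NormedModule phi t.
Proof.
intros H. apply filterlim_locally. intros eps.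
destruct (H eps (cond_pos eps)) as [d [d0 Hd]].
exists (mkposreal d d0). intros s Hs.
assert (Hs' := Hd s Hs).
apply C_NormedModule_mixin_compat1. exact Hs'.
Qed.

Lemma ex_CRInt_cont (phi : R -> C) (a b : R) :
  (forall t, (Rmin a b <= t <= Rmax a b)%R -> path_cont phi t) -> ex_CRInt phi a b.
Proof.
intros H. apply (@ex_RInt_continuous C_R_CompleteNormedModule).
intros t Ht. apply path_cont_continuous, H, Ht.
Qed.

Lemma CRInt_correct (phi : R -> C) (a b : R) :
  ex_CRInt phi a b -> @is_RInt C_R_NormedModule phi a b (CRInt phi a b).
Proof. apply (@RInt_correct C_R_CompleteNormedModule). Qed.

Lemma CRInt_unique (phi : R -> C) (a b : R) (l : C) :
  @is_RInt C_R_NormedModule phi a b l -> CRInt phi a b = l.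
Proof. apply (@is_RInt_unique C_R_CompleteNormedModule). Qed.

Lemma CRInt_Chasles (phi : R -> C) (a b c : R) :
  ex_CRInt phi a b -> ex_CRInt phi b c ->
  CRInt phi a c = CRInt phi a b + CRInt phi b c.
Proof. intros H1 H2. symmetry. apply (@RInt_Chasles C_R_CompleteNormedModule phi a b c H1 H2). Qed.

Lemma CRInt_swap (phi : R -> C) (a b : R) : ex_CRInt phi b a ->
  CRInt phi a b = - CRInt phi b a.
Proof.
intros H. apply CRInt_unique.
apply (@is_RInt_swap C_R_NormedModule), CRInt_correct, H.
Qed.

Lemma CRInt_minus (phi psi : R -> C) (a b : R) :
  ex_CRInt phi a b -> ex_CRInt psi a b ->
  CRInt (fun t => phi t - psi t) a b = CRInt phi a b - CRInt psi a b.
Proof.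
intros H1 H2. apply CRInt_unique.
apply (@is_RInt_minus C_R_NormedModule); apply CRInt_correct; assumption.
Qed.

Lemma ex_CRInt_minus (phi psi : R -> C) (a b : R) :
  ex_CRInt phi a b -> ex_CRInt psi a b -> ex_CRInt (fun t => phi t - psi t) a b.
Proof.
intros H1 H2. exists (CRInt phi a b - CRInt psi a b).
apply (@is_RInt_minus C_R_NormedModule); apply CRInt_correct; assumption.
Qed.

Lemma CRInt_ext (phi psi : R -> C) (a b : R) :
  (forall t, (Rmin a b < t < Rmax a b)%R -> phi t = psi t) ->
  CRInt phi a b = CRInt psi a b.
Proof. apply (@RInt_ext C_R_CompleteNormedModule). Qed.

(** The integral lives in a real module, so a complex factor has to be treated through real and
    imaginary parts. *)
Lemma is_CRInt_scal (c : C) (phi : R -> C) (a b : R) (l : C) :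
  @is_RInt C_R_NormedModule phi a b l ->
  @is_RInt C_R_NormedModule (fun t => c * phi t) a b (c * l).
Proof.
intros H.
assert (H1 := is_RInt_fct_extend_fst (U := R_NormedModule) (V := R_NormedModule) phi a b l H).
assert (H2 := is_RInt_fct_extend_snd (U := R_NormedModule) (V := R_NormedModule) phi a b l H).
apply (is_RInt_fct_extend_pair (U := R_NormedModule) (V := R_NormedModule)); simpl.
- apply (@is_RInt_minus R_NormedModule);
  apply (@is_RInt_scal R_NormedModule); assumption.
- apply (@is_RInt_plus R_NormedModule);
  apply (@is_RInt_scal R_NormedModule); assumption.
Qed.

Lemma CRInt_scal (c : C) (phi : R -> C) (a b : R) : ex_CRInt phi a b ->
  CRInt (fun t => c * phi t) a b = c * CRInt phi a b.
Proof. intros H. apply CRInt_unique, is_CRInt_scal, CRInt_correct, H. Qed.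

Lemma ex_CRInt_scal (c : C) (phi : R -> C) (a b : R) : ex_CRInt phi a b ->
  ex_CRInt (fun t => c * phi t) a b.
Proof. intros H. exists (c * CRInt phi a b). apply is_CRInt_scal, CRInt_correct, H. Qed.

Lemma CRInt_bound (phi : R -> C) (a b M : R) : (a <= b)%R -> ex_CRInt phi a b ->
  (forall t, (a <= t <= b)%R -> (Cmod (phi t) <= M)%R) ->
  (Cmod (CRInt phi a b) <= M * (b - a))%R.
Proof.
intros Hab Hex H. rewrite Rmult_comm.
rewrite Cmod_norm.
assert (H' : forall t, (a <= t <= b)%R -> (@norm R_AbsRing C_R_NormedModule (phi t) <= M)%R).
{ intros t Ht. specialize (H t Ht). rewrite Cmod_norm in H. exact H. }
exact (@norm_RInt_le_const C_R_NormedModule phi a b _ M Hab H' (CRInt_correct _ _ _ Hex)).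
Qed.

Lemma is_linear_Cmult (l : C) :
  @is_linear R_AbsRing C_R_NormedModule C_R_NormedModule (fun h => l * h).
Proof.
split.
- intros x y. apply Cmult_plus_distr_l.
- intros k x. rewrite !scal_R_Cmult. change (l * (k * x) = k * (l * x)). ring.
- exists (Cmod l + 1)%R. split; [generalize (Cmod_ge_0 l); lra|].
  intros x.
  change (@norm R_AbsRing (prod_NormedModule R_AbsRing R_NormedModule R_NormedModule) (l * x)%C <=
    (Cmod l + 1) * @norm R_AbsRing (prod_NormedModule R_AbsRing R_NormedModule R_NormedModule) x)%R.
  rewrite <- !Cmod_norm, Cmod_mult. generalize (Cmod_ge_0 x). nra.
Qed.

(** Halving the radius absorbs the factor sqrt 2 between the maximum norm and the modulus. *)
Lemma ball_C_Cmod (z y : C) (d : R) (d0 : (0 < d)%R) :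
  @ball C_R_NormedModule z (d / 2) y -> (Cmod (y - z) < d)%R.
Proof.
intros H.
assert (d1 : (0 < d / 2)%R) by lra.
assert (T := C_NormedModule_mixin_compat2 z y (mkposreal _ d1) H).
change (Cmod (y - z) < sqrt 2 * (d / 2))%R in T.
assert (sqrt 2 <= 2)%R.
{ rewrite <- (sqrt_square 2) at 2 by lra. apply sqrt_le_1; lra. }
nra.
Qed.

(** Recasts the complex derivative as a real differential, namely multiplication by [l], so that it
    can be composed with paths defined on the reals. *)
Lemma is_Cderive_filterdiff (f : C -> C) (z l : C) : is_Cderive f z l ->
  @filterdiff R_AbsRing C_R_NormedModule C_R_NormedModule f
    (@locally C_R_NormedModule z) (fun h => l * h).
Proof.
intros H. split; [apply is_linear_Cmult|].
intros x Hx.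
assert (Hz : z = x) by exact (@is_filter_lim_locally_unique R_AbsRing C_R_NormedModule z x Hx).
subst x. intros eps.
destruct (proj1 (is_Cderive_eps _ _ _) H eps (cond_pos eps)) as [d [d0 Hd]].
assert (d1 : (0 < d / 2)%R) by lra.
exists (mkposreal _ d1). intros y Hy.
assert (G := Hd y (ball_C_Cmod _ _ _ d0 Hy)).
rewrite (Cmod_norm (f y - f z - l * (y - z))), (Cmod_norm (y - z)) in G. exact G.
Qed.

Lemma path_derive_comp (f : C -> C) (phi : R -> C) (t : R) (l d : C) :
  is_Cderive f (phi t) l -> path_derive phi t d ->
  path_derive (fun s => f (phi s)) t (l * d).
Proof.
intros Hf Hphi. unfold path_derive, is_derive in *.
assert (H := @filterdiff_comp' R_AbsRing _ _ _ phi f t _ _ Hphi (is_Cderive_filterdiff _ _ _ Hf)).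
eapply filterdiff_ext_lin; [exact H|].
intros y. rewrite !scal_R_Cmult. change (l * (y * d) = y * (l * d)). ring.
Qed.

Lemma path_derive_pair (u v : R -> R) (t du dv : R) :
  is_derive u t du -> is_derive v t dv -> path_derive (fun s => (u s, v s)) t (du, dv).
Proof.
intros Hu Hv. unfold path_derive, is_derive in *.
eapply filterdiff_ext_lin.
- apply (@filterdiff_comp'_2 R_AbsRing R_NormedModule R_NormedModule R_NormedModule C_R_NormedModule
   u v (fun a b => (a, b)) t _ _ (fun a b => (a, b)) Hu Hv).
  simpl. apply (filterdiff_ext (fun x => x)).
  + intros [a b]; reflexivity.
  + eapply filterdiff_ext_lin. apply filterdiff_id. intros [a b]; reflexivity.
- intros y. reflexivity.
Qed.

Lemma path_derive_re (phi : R -> C) (t : R) (d : C) :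
  path_derive phi t d -> is_derive (fun s => Re (phi s)) t (Re d).
Proof.
intros H. unfold path_derive, is_derive in *.
assert (T := @filterdiff_comp' R_AbsRing _ _ _ phi (fun z : C_R_NormedModule => Re z) t _ (fun z : C_R_NormedModule => Re z) H).
eapply filterdiff_ext_lin.
- apply T. apply filterdiff_linear. apply (@is_linear_fst R_AbsRing R_NormedModule R_NormedModule).
- intros y. reflexivity.
Qed.

Lemma path_derive_im (phi : R -> C) (t : R) (d : C) :
  path_derive phi t d -> is_derive (fun s => Im (phi s)) t (Im d).
Proof.
intros H. unfold path_derive, is_derive in *.
assert (T := @filterdiff_comp' R_AbsRing _ _ _ phi (fun z : C_R_NormedModule => Im z) t _ (fun z : C_R_NormedModule => Im z) H).
eapply filterdiff_ext_lin.
- apply T. apply filterdiff_linear. apply (@is_linear_snd R_AbsRing R_NormedModule R_NormedModule).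
- intros y. reflexivity.
Qed.

Lemma path_derive_cont (phi : R -> C) (t : R) (d : C) : path_derive phi t d -> path_cont phi t.
Proof.
intros H eps He.
assert (T : @continuous R_UniformSpace C_R_NormedModule phi t).
{ apply (@ex_derive_continuous R_AbsRing C_R_NormedModule). exists d; exact H. }
assert (e1 : (0 < eps / 2)%R) by lra.
destruct (proj1 (filterlim_locally _ _) T (mkposreal _ e1)) as [r Hr].
exists r; split; [apply cond_pos|]. intros s Hs. apply ball_C_Cmod; auto.
Qed.

Lemma path_cont_comp (f : C -> C) (phi : R -> C) (t : R) :
  ex_Cderive f (phi t) -> path_cont phi t -> path_cont (fun s => f (phi s)) t.
Proof.
intros [l Hl] H eps He.
destruct (is_Cderive_continuous f (phi t) l Hl eps He) as [d [d0 Hd]].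
destruct (H d d0) as [r [r0 Hr]].
exists r; split; auto.
Qed.

Lemma path_cont_ext (phi psi : R -> C) (t : R) : (forall s, phi s = psi s) ->
  path_cont phi t -> path_cont psi t.
Proof.
intros E H eps He. destruct (H eps He) as [d [d0 Hd]]. exists d; split; auto.
intros s Hs. rewrite <- !E. auto.
Qed.

Lemma CRInt_derive (phi dphi : R -> C) (a b : R) :
  (forall t, (Rmin a b <= t <= Rmax a b)%R -> path_derive phi t (dphi t)) ->
  (forall t, (Rmin a b <= t <= Rmax a b)%R -> path_cont dphi t) ->
  CRInt dphi a b = phi b - phi a.
Proof.
intros H1 H2. apply CRInt_unique.
apply (@is_RInt_derive C_R_CompleteNormedModule phi dphi a b H1).
intros t Ht. apply path_cont_continuous, H2, Ht.
Qed.

(** * Goursat's theorem and primitives *)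

(** Counterclockwise boundary integral: bottom, right, top, left. The factor [Ci] is dz/dy on the
    vertical sides. *)
Definition rect_int (f : C -> C) (a b c d : R) : C :=
  CRInt (fun x => f (x, c)) a b + Ci * CRInt (fun y => f (b, y)) c d
  - CRInt (fun x => f (x, d)) a b - Ci * CRInt (fun y => f (a, y)) c d.

Definition holo_rect (f : C -> C) (a b c d : R) : Prop :=
  forall x y, (a <= x <= b)%R -> (c <= y <= d)%R -> ex_Cderive f (x, y).

Lemma path_derive_hor (y t : R) : path_derive (fun x => (x, y)) t 1.
Proof. apply path_derive_pair; [apply (is_derive_id (K := R_AbsRing))|apply (is_derive_const (K := R_AbsRing) (V := R_NormedModule))]. Qed.

Lemma path_derive_ver (x t : R) : path_derive (fun y => (x, y)) t Ci.
Proof. apply path_derive_pair; [apply (is_derive_const (K := R_AbsRing) (V := R_NormedModule))|apply (is_derive_id (K := R_AbsRing))]. Qed.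

Lemma path_cont_hor (f : C -> C) (y t : R) : ex_Cderive f (t, y) ->
  path_cont (fun x => f (x, y)) t.
Proof.
intros H. apply (path_cont_comp f (fun x => (x, y))); [exact H|].
apply (path_derive_cont _ _ 1), path_derive_hor.
Qed.

Lemma path_cont_ver (f : C -> C) (x t : R) : ex_Cderive f (x, t) ->
  path_cont (fun y => f (x, y)) t.
Proof.
intros H. apply (path_cont_comp f (fun y => (x, y))); [exact H|].
apply (path_derive_cont _ _ Ci), path_derive_ver.
Qed.

Lemma ex_CRInt_hor (f : C -> C) (a b y : R) :
  (forall x, (Rmin a b <= x <= Rmax a b)%R -> ex_Cderive f (x, y)) ->
  ex_CRInt (fun x => f (x, y)) a b.
Proof. intros H. apply ex_CRInt_cont. intros t Ht. apply path_cont_hor, H, Ht. Qed.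

Lemma ex_CRInt_ver (f : C -> C) (c d x : R) :
  (forall y, (Rmin c d <= y <= Rmax c d)%R -> ex_Cderive f (x, y)) ->
  ex_CRInt (fun y => f (x, y)) c d.
Proof. intros H. apply ex_CRInt_cont. intros t Ht. apply path_cont_ver, H, Ht. Qed.

Ltac rect_ex :=
  match goal with
  | |- ex_CRInt (fun x => ?f (x, ?y)) _ _ => apply (ex_CRInt_hor f)
  | |- ex_CRInt (fun y => ?f (?x, y)) _ _ => apply (ex_CRInt_ver f)
  end; rewrite Rmin_left, Rmax_right by lra;
  let t := fresh in let Ht := fresh in intros t Ht;
  match goal with H : holo_rect _ _ _ _ _ |- _ => apply H; lra end.

Lemma rect_int_split_x (f : C -> C) (a m b c d : R) :
  (a <= m <= b)%R -> (c <= d)%R -> holo_rect f a b c d ->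
  rect_int f a b c d = rect_int f a m c d + rect_int f m b c d.
Proof.
intros Hm Hcd H. unfold rect_int.
rewrite (CRInt_Chasles (fun x => f (x, c)) a m b) by rect_ex.
rewrite (CRInt_Chasles (fun x => f (x, d)) a m b) by rect_ex.
ring.
Qed.

Lemma rect_int_split_y (f : C -> C) (a b c m d : R) :
  (a <= b)%R -> (c <= m <= d)%R -> holo_rect f a b c d ->
  rect_int f a b c d = rect_int f a b c m + rect_int f a b m d.
Proof.
intros Hm Hcd H. unfold rect_int.
rewrite (CRInt_Chasles (fun y => f (a, y)) c m d) by rect_ex.
rewrite (CRInt_Chasles (fun y => f (b, y)) c m d) by rect_ex.
ring.
Qed.

(** The explicit primitive [P] makes the four sides telescope. This is the part of [f] that is
    subtracted near the limit point in Goursat's argument. *)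
Lemma rect_int_affine (c0 c1 : C) (a b c d : R) :
  rect_int (fun z => c0 + c1 * z) a b c d = 0.
Proof.
set (P := fun z => c0 * z + c1 / 2 * (z * z)).
assert (HP : forall z, is_Cderive P z (c0 + c1 * z)).
{ intros z. unfold P.
  replace (c0 + c1 * z) with ((0 * z + c0 * 1) + (0 * (z * z) + c1 / 2 * (1 * z + z * 1)))
    by (field; intros E; apply RtoC_inj in E; lra).
  apply (is_Cderive_plus (fun z => c0 * z) (fun z => c1 / 2 * (z * z))).
  - apply (is_Cderive_mult (fun _ => c0) (fun z => z)); [apply is_Cderive_const|apply is_Cderive_id].
  - apply (is_Cderive_mult (fun _ => c1 / 2) (fun z => z * z)); [apply is_Cderive_const|].
    apply (is_Cderive_mult (fun z => z) (fun z => z)); apply is_Cderive_id. }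
assert (HA : forall z, ex_Cderive (fun z => c0 + c1 * z) z).
{ intros z. exists (0 + (0 * z + c1 * 1)).
  apply (is_Cderive_plus (fun _ => c0) (fun z => c1 * z)); [apply is_Cderive_const|].
  apply (is_Cderive_mult (fun _ => c1) (fun z => z)); [apply is_Cderive_const|apply is_Cderive_id]. }
assert (Hh : forall y u v, CRInt (fun x => c0 + c1 * (x, y)) u v = P (v, y) - P (u, y)).
{ intros y u v. apply (CRInt_derive (fun x => P (x, y))).
  - intros t _. rewrite <- (Cmult_1_r (c0 + c1 * (t, y))).
    apply (path_derive_comp P); [apply HP|apply path_derive_hor].
  - intros t _. apply (path_cont_hor (fun z => c0 + c1 * z)), HA. }
assert (Hv : forall x u v, Ci * CRInt (fun y => c0 + c1 * (x, y)) u v = P (x, v) - P (x, u)).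
{ intros x u v. rewrite <- CRInt_scal.
  2: apply (ex_CRInt_ver (fun z => c0 + c1 * z)); intros; apply HA.
  apply (CRInt_derive (fun y => P (x, y))).
  - intros t _. rewrite (Cmult_comm Ci).
    apply (path_derive_comp P); [apply HP|apply path_derive_ver].
  - intros t _. apply (path_cont_comp (fun w => Ci * w) (fun y => c0 + c1 * (x, y))).
    + exists (0 * (c0 + c1 * (x, t)) + Ci * 1).
      apply (is_Cderive_mult (fun _ => Ci) (fun z => z)); [apply is_Cderive_const|apply is_Cderive_id].
    + apply (path_cont_ver (fun z => c0 + c1 * z)), HA. }
unfold rect_int. rewrite !Hh, !Hv. ring.
Qed.

Lemma Cmod_pair_le (x y : R) : (Cmod (x, y) <= Rabs x + Rabs y)%R.
Proof.
replace ((x, y) : C) with (RtoC x + Ci * RtoC y).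
- eapply Rle_trans; [apply Cmod_triangle|].
  rewrite Cmod_mult, Cmod_Ci, !Cmod_R. lra.
- unfold Ci, RtoC, Cplus, Cmult; simpl; f_equal; ring.
Qed.

Lemma rect_int_bound (f : C -> C) (a b c d M : R) :
  (a <= b)%R -> (c <= d)%R -> holo_rect f a b c d ->
  (forall x y, (a <= x <= b)%R -> (c <= y <= d)%R -> (Cmod (f (x, y)) <= M)%R) ->
  (Cmod (rect_int f a b c d) <= 2 * M * ((b - a) + (d - c)))%R.
Proof.
intros Hab Hcd H HM. unfold rect_int, Cminus.
assert (H1 : (Cmod (CRInt (fun x => f (x, c)) a b) <= M * (b - a))%R)
  by (apply CRInt_bound; [lra|rect_ex|intros; apply HM; lra]).
assert (H2 : (Cmod (CRInt (fun x => f (x, d)) a b) <= M * (b - a))%R)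
  by (apply CRInt_bound; [lra|rect_ex|intros; apply HM; lra]).
assert (H3 : (Cmod (CRInt (fun y => f (a, y)) c d) <= M * (d - c))%R)
  by (apply CRInt_bound; [lra|rect_ex|intros; apply HM; lra]).
assert (H4 : (Cmod (CRInt (fun y => f (b, y)) c d) <= M * (d - c))%R)
  by (apply CRInt_bound; [lra|rect_ex|intros; apply HM; lra]).
eapply Rle_trans; [apply Cmod_triangle|].
eapply Rle_trans; [apply Rplus_le_compat_r, Cmod_triangle|].
eapply Rle_trans; [apply Rplus_le_compat_r, Rplus_le_compat_r, Cmod_triangle|].
rewrite !Cmod_opp, !Cmod_mult, Cmod_Ci. lra.
Qed.

Lemma rect_int_minus (f g : C -> C) (a b c d : R) :
  (a <= b)%R -> (c <= d)%R -> holo_rect f a b c d -> holo_rect g a b c d ->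
  rect_int (fun z => f z - g z) a b c d = rect_int f a b c d - rect_int g a b c d.
Proof.
intros Hab Hcd Hf Hg. unfold rect_int.
rewrite (CRInt_minus (fun x => f (x, c)) (fun x => g (x, c))) by rect_ex.
rewrite (CRInt_minus (fun x => f (x, d)) (fun x => g (x, d))) by rect_ex.
rewrite (CRInt_minus (fun y => f (a, y)) (fun y => g (a, y))) by rect_ex.
rewrite (CRInt_minus (fun y => f (b, y)) (fun y => g (b, y))) by rect_ex.
ring.
Qed.

(* [I x y w h] is the modulus of the integral around the rectangle of corner [(x, y)] and sides
   [w], [h]; the result is the corner of a quarter carrying at least a quarter of it. *)
Definition quarter_choice (I : R -> R -> R -> R -> R) (w h : R) (p : R * R) : R * R :=
  let q := (I (fst p) (snd p) w h / 4)%R in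
  if Rle_dec q (I (fst p) (snd p) (w / 2) (h / 2))%R then p
  else if Rle_dec q (I (fst p + w / 2) (snd p) (w / 2) (h / 2))%R
  then (fst p + w / 2, snd p)%R
  else if Rle_dec q (I (fst p) (snd p + h / 2) (w / 2) (h / 2))%R
  then (fst p, snd p + h / 2)%R
  else (fst p + w / 2, snd p + h / 2)%R.

Fixpoint quarter_seq (I : R -> R -> R -> R -> R) (a c w h : R) (n : nat) : R * R :=
  match n with
  | O => (a, c)
  | S n => quarter_choice I (w / 2 ^ n) (h / 2 ^ n) (quarter_seq I a c w h n)
  end.

(** The common point is the supremum of the left endpoints: by [UL], each right endpoint lies above
    all of them. *)
Lemma nested_intervals (u l : nat -> R) :
  (forall n, (u n <= u (S n))%R) -> (forall n, (u (S n) + l (S n) <= u n + l n)%R) ->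
  (forall n, (0 <= l n)%R) -> exists x, forall n, (u n <= x <= u n + l n)%R.
Proof.
intros Hu Hl H0.
assert (U : forall n m, (u n <= u (n + m)%nat)%R).
{ intros n m; induction m as [|m IH]; [rewrite Nat.add_0_r; lra|].
  rewrite Nat.add_succ_r. specialize (Hu (n + m)%nat). lra. }
assert (L : forall n m, (u (n + m)%nat + l (n + m)%nat <= u n + l n)%R).
{ intros n m; induction m as [|m IH]; [rewrite Nat.add_0_r; lra|].
  rewrite Nat.add_succ_r. specialize (Hl (n + m)%nat). lra. }
assert (UL : forall n m, (u n <= u m + l m)%R).
{ intros n m. destruct (Nat.le_ge_cases n m) as [E|E].
  - specialize (U n (m - n)%nat). replace (n + (m - n))%nat with m in U by lia.
    specialize (H0 m). lra.
  - specialize (L m (n - m)%nat). replace (m + (n - m))%nat with n in L by lia.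
    specialize (H0 n). lra. }
destruct (completeness (fun x => exists n, x = u n)) as [x [Hx1 Hx2]].
- exists (u 0%nat + l 0%nat)%R. intros y [n ->]. apply UL.
- exists (u 0%nat); exists 0%nat; reflexivity.
- exists x. intros n; split.
  + apply Hx1; exists n; reflexivity.
  + apply Hx2. intros y [m ->]. apply UL.
Qed.

(** Repeated quartering keeps at least 4^-n of the integral ([HI]). Around the common point of the
    rectangles [f] is affine up to [eps] times the distance, and this error integrates to at most a
    constant times eps 4^-n. Comparing the two forces the integral to be 0. *)
Theorem Goursat_rect (f : C -> C) (a b c d : R) :
  (a <= b)%R -> (c <= d)%R -> holo_rect f a b c d -> rect_int f a b c d = 0.
Proof.
intros Hab Hcd H.
set (w := (b - a)%R). set (h := (d - c)%R).
set (I := fun x y w h => Cmod (rect_int f x (x + w) y (y + h))).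
set (s := quarter_seq I a c w h).
assert (Hs0 : s 0%nat = (a, c)) by reflexivity.
assert (HsS : forall n, s (S n) = quarter_choice I (w / 2 ^ n) (h / 2 ^ n) (s n)) by reflexivity.
clearbody s.
assert (Hw : forall n, (0 <= w / 2 ^ n)%R).
{ intros n. apply Rmult_le_pos; [unfold w; lra|]. left; apply Rinv_0_lt_compat, pow_lt; lra. }
assert (Hh : forall n, (0 <= h / 2 ^ n)%R).
{ intros n. apply Rmult_le_pos; [unfold h; lra|]. left; apply Rinv_0_lt_compat, pow_lt; lra. }
assert (E2 : forall x n, (x / 2 ^ S n = x / 2 ^ n / 2)%R).
{ intros x n. simpl. field. apply pow_nonzero; lra. }
assert (Hstep : forall n,
  (fst (s n) <= fst (s (S n)))%R /\
  (fst (s (S n)) + w / 2 ^ S n <= fst (s n) + w / 2 ^ n)%R /\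
  (snd (s n) <= snd (s (S n)))%R /\
  (snd (s (S n)) + h / 2 ^ S n <= snd (s n) + h / 2 ^ n)%R).
{ intros n. rewrite HsS, !E2. unfold quarter_choice.
  specialize (Hw n). specialize (Hh n).
  repeat destruct Rle_dec; simpl; lra. }
destruct (nested_intervals (fun n => fst (s n)) (fun n => (w / 2 ^ n)%R)) as [x Hx];
  [intros n; apply (Hstep n)|intros n; apply (Hstep n)|exact Hw|].
destruct (nested_intervals (fun n => snd (s n)) (fun n => (h / 2 ^ n)%R)) as [y Hy];
  [intros n; apply (Hstep n)|intros n; apply (Hstep n)|exact Hh|].
assert (Hin : forall n, (a <= fst (s n))%R /\ (fst (s n) + w / 2 ^ n <= b)%R /\
   (c <= snd (s n))%R /\ (snd (s n) + h / 2 ^ n <= d)%R).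
{ induction n as [|n IH].
  - rewrite Hs0; simpl. unfold w, h. lra.
  - specialize (Hstep n). lra. }
assert (HI : forall n, (I a c w h / 4 ^ n <= I (fst (s n)) (snd (s n)) (w / 2 ^ n) (h / 2 ^ n))%R).
{ induction n as [|n IH].
  - rewrite Hs0; simpl. rewrite !Rdiv_1_r. lra.
  - assert (Hq : (I (fst (s n)) (snd (s n)) (w / 2 ^ n) (h / 2 ^ n) / 4 <=
       I (fst (s (S n))) (snd (s (S n))) (w / 2 ^ S n) (h / 2 ^ S n))%R).
    { rewrite HsS, !E2. specialize (Hin n). specialize (Hw n). specialize (Hh n).
      revert Hin Hw Hh. generalize (w / 2 ^ n)%R (h / 2 ^ n)%R (s n).
      intros W K [x0 y0]; simpl. intros Hin HW HK.
      unfold quarter_choice; simpl.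
      destruct Rle_dec as [G|G1]; [exact G|].
      destruct Rle_dec as [G|G2]; [exact G|].
      destruct Rle_dec as [G|G3]; [exact G|].
      apply Rnot_le_lt in G1, G2, G3. simpl. unfold I in *.
      (* The three failed tests put the other quarters strictly below a quarter of the whole, so the
         triangle inequality leaves at least a quarter for the last one. *)
      assert (T : rect_int f x0 (x0 + W) y0 (y0 + K) =
        (rect_int f x0 (x0 + W / 2) y0 (y0 + K / 2)
         + rect_int f x0 (x0 + W / 2) (y0 + K / 2) (y0 + K / 2 + K / 2))
        + (rect_int f (x0 + W / 2) (x0 + W / 2 + W / 2) y0 (y0 + K / 2)
         + rect_int f (x0 + W / 2) (x0 + W / 2 + W / 2) (y0 + K / 2) (y0 + K / 2 + K / 2))).
      { replace (x0 + W / 2 + W / 2)%R with (x0 + W)%R by field.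
        replace (y0 + K / 2 + K / 2)%R with (y0 + K)%R by field.
        rewrite (rect_int_split_x f x0 (x0 + W / 2)); [|lra|lra|].
        2: intros u v Hu Hv; apply H; lra.
        rewrite (rect_int_split_y f _ _ y0 (y0 + K / 2) (y0 + K)) by
          (try lra; intros u v Hu Hv; apply H; lra).
        rewrite (rect_int_split_y f _ _ y0 (y0 + K / 2) (y0 + K)) by
          (try lra; intros u v Hu Hv; apply H; lra).
        reflexivity. }
      assert (T1 := f_equal Cmod T).
      assert (T2 := Cmod_triangle (rect_int f x0 (x0 + W / 2) y0 (y0 + K / 2)
         + rect_int f x0 (x0 + W / 2) (y0 + K / 2) (y0 + K / 2 + K / 2))
         (rect_int f (x0 + W / 2) (x0 + W / 2 + W / 2) y0 (y0 + K / 2)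
         + rect_int f (x0 + W / 2) (x0 + W / 2 + W / 2) (y0 + K / 2) (y0 + K / 2 + K / 2))).
      assert (T3 := Cmod_triangle (rect_int f x0 (x0 + W / 2) y0 (y0 + K / 2))
          (rect_int f x0 (x0 + W / 2) (y0 + K / 2) (y0 + K / 2 + K / 2))).
      assert (T4 := Cmod_triangle
         (rect_int f (x0 + W / 2) (x0 + W / 2 + W / 2) y0 (y0 + K / 2))
         (rect_int f (x0 + W / 2) (x0 + W / 2 + W / 2) (y0 + K / 2) (y0 + K / 2 + K / 2))).
      lra. }
    eapply Rle_trans; [|exact Hq].
    replace (I a c w h / 4 ^ S n)%R with (I a c w h / 4 ^ n / 4)%R.
    + lra.
    + simpl. field. apply pow_nonzero; lra. }
assert (Hxy : ex_Cderive f (x, y)).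
{ apply H; specialize (Hx 0%nat); specialize (Hy 0%nat); rewrite Hs0 in *; simpl in *;
  unfold w, h in *; rewrite Rdiv_1_r in *; lra. }
destruct Hxy as [l Hl].
(* The integrand error and the perimeter each scale like 2^-n, so their product carries exactly the
   4^-n of [HI], which cancels. *)
assert (Heps : forall eps : R, (0 < eps)%R -> (I a c w h <= 2 * eps * (w + h) ^ 2)%R).
{ intros eps He.
  destruct (proj1 (is_Cderive_eps _ _ _) Hl eps He) as [r [r0 Hr]].
  assert (Hn : exists n, ((w + h) / 2 ^ n < r)%R).
  { destruct (Pow_x_infinity 2 ltac:(rewrite Rabs_right; lra) ((w + h) / r + 1)) as [N HN].
    exists N. specialize (HN N (le_n _)).
    rewrite Rabs_right in HN by (apply Rle_ge, pow_le; lra).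
    assert (P : (0 < 2 ^ N)%R) by (apply pow_lt; lra).
    apply (Rmult_lt_reg_r (2 ^ N)); auto.
    unfold Rdiv; rewrite Rmult_assoc, Rinv_l by lra. rewrite Rmult_1_r.
    assert (Q : ((w + h) = (w + h) / r * r)%R) by (field; lra).
    rewrite Q. nra. }
  destruct Hn as [n Hn].
  specialize (HI n). specialize (Hin n). specialize (Hx n). specialize (Hy n).
  specialize (Hw n). specialize (Hh n).
  assert (P : (0 < 2 ^ n)%R) by (apply pow_lt; lra).
  assert (P4 : (4 ^ n = 2 ^ n * 2 ^ n)%R) by (rewrite <- Rpow_mult_distr; f_equal; lra).
  assert (Ew : (w = w / 2 ^ n * 2 ^ n)%R) by (field; lra).
  assert (Eh : (h = h / 2 ^ n * 2 ^ n)%R) by (field; lra).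
  assert (Ewh : ((w + h) / 2 ^ n = w / 2 ^ n + h / 2 ^ n)%R) by (field; lra).
  rewrite Ewh in Hn.
  set (W := (w / 2 ^ n)%R) in *. set (K := (h / 2 ^ n)%R) in *.
  set (x0 := fst (s n)) in *. set (y0 := snd (s n)) in *.
  (* First-order Taylor polynomial of [f] at the limit point; its boundary integral vanishes. *)
  set (A := fun z : C => (f (x, y) - l * (x, y)) + l * z).
  assert (HA : forall z, ex_Cderive A z).
  { intros z. exists (0 + (0 * z + l * 1)).
    apply (is_Cderive_plus (fun _ => f (x, y) - l * (x, y)) (fun z => l * z)); [apply is_Cderive_const|].
    apply (is_Cderive_mult (fun _ => l) (fun z => z)); [apply is_Cderive_const|apply is_Cderive_id]. }
  assert (Hsub : holo_rect f x0 (x0 + W) y0 (y0 + K)).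
  { intros u v Hu Hv. apply H; lra. }
  assert (B : (I x0 y0 W K <= 2 * (eps * (W + K)) * (W + K))%R).
  { unfold I.
    replace (rect_int f x0 (x0 + W) y0 (y0 + K)) with
      (rect_int (fun z => f z - A z) x0 (x0 + W) y0 (y0 + K)).
    2:{ rewrite rect_int_minus; [|lra|lra|exact Hsub|intros u v _ _; apply HA].
        unfold A. rewrite rect_int_affine. ring. }
    eapply Rle_trans; [apply (rect_int_bound _ _ _ _ _ (eps * (W + K))%R)|].
    - lra.
    - lra.
    - intros u v Hu Hv. destruct (Hsub u v Hu Hv) as [l1 Hl1].
      destruct (HA (u, v)) as [l2 Hl2]. exists (l1 - l2).
      apply is_Cderive_minus; assumption.
    - intros u v Hu Hv.
      assert (D : (Cmod ((u, v) - (x, y)) <= W + K)%R).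
      { change ((u, v) - (x, y)) with ((u - x, v - y)%R : C).
        eapply Rle_trans; [apply Cmod_pair_le|].
        apply Rplus_le_compat; apply Rabs_le; lra. }
      unfold A.
      replace (f (u, v) - (f (x, y) - l * (x, y) + l * (u, v)))
        with (f (u, v) - f (x, y) - l * ((u, v) - (x, y))) by ring.
      eapply Rle_trans; [apply Hr; lra|]. apply Rmult_le_compat_l; lra.
    - right; ring. }
  apply Rmult_le_reg_r with (/ 4 ^ n)%R; [apply Rinv_0_lt_compat, pow_lt; lra|].
  eapply Rle_trans; [exact HI|]. eapply Rle_trans; [exact B|].
  right. rewrite P4, Ew at 1. rewrite Eh at 1. field. lra. }
replace (rect_int f a b c d) with (rect_int f a (a + w) c (c + h)).
2:{ unfold w, h. f_equal; ring. }
apply Cmod_eq_0. apply Rle_antisym; [|apply Cmod_ge_0].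
apply Rnot_lt_le. intros G. fold (I a c w h) in G.
assert (K0 : (0 <= (w + h) ^ 2)%R) by apply pow2_ge_0.
(* With q for this [eps], [Heps] gives q (4 S + 4) <= 2 q S for S = (w + h)^2, which is absurd for q
   > 0. The added 4 keeps the divisor positive for a degenerate rectangle. *)
specialize (Heps (I a c w h / (4 * (w + h) ^ 2 + 4))%R).
assert (G1 : (0 < I a c w h / (4 * (w + h) ^ 2 + 4))%R) by (apply Rdiv_lt_0_compat; lra).
specialize (Heps G1).
assert (G2 : (I a c w h = I a c w h / (4 * (w + h) ^ 2 + 4) * (4 * (w + h) ^ 2 + 4))%R)
  by (field; lra).
set (q := (I a c w h / (4 * (w + h) ^ 2 + 4))%R) in *. nra.
Qed.

Lemma Cmod_mono (s t s' t' : R) :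
  (Rabs s <= Rabs s')%R -> (Rabs t <= Rabs t')%R -> (Cmod (s, t) <= Cmod (s', t'))%R.
Proof.
intros H1 H2. unfold Cmod; simpl. apply sqrt_le_1_alt.
apply Rsqr_le_abs_1 in H1, H2. unfold Rsqr in *. lra.
Qed.

Lemma CRInt_bound_abs (phi : R -> C) (a b M : R) : ex_CRInt phi a b ->
  (forall t, (Rmin a b <= t <= Rmax a b)%R -> (Cmod (phi t) <= M)%R) ->
  (Cmod (CRInt phi a b) <= M * Rabs (b - a))%R.
Proof.
intros Hex H. destruct (Rle_dec a b) as [E|E].
- rewrite Rabs_right by lra. rewrite Rmin_left, Rmax_right in H by lra.
  apply CRInt_bound; auto.
- assert (Hex' : ex_CRInt phi b a) by (apply (@ex_RInt_swap C_R_NormedModule), Hex).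
  rewrite CRInt_swap by exact Hex'.
  rewrite Rmin_right, Rmax_left in H by lra.
  rewrite Cmod_opp, Rabs_left1 by lra.
  replace (- (b - a))%R with (a - b)%R by ring.
  apply CRInt_bound; auto; lra.
Qed.

(** In the construction of the primitive the endpoints may come in either order; exchanging a pair
    only changes the sign of the integral. *)
Lemma Goursat_rect_signed (f : C -> C) (a b c d : R) :
  holo_rect f (Rmin a b) (Rmax a b) (Rmin c d) (Rmax c d) -> rect_int f a b c d = 0.
Proof.
assert (G : forall a b c d, (a <= b)%R -> 
  holo_rect f (Rmin a b) (Rmax a b) (Rmin c d) (Rmax c d) -> rect_int f a b c d = 0).
{ clear a b c d. intros a b c d Hab H. rewrite Rmin_left, Rmax_right in H by lra.
  destruct (Rle_dec c d) as [E|E].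
  - rewrite Rmin_left, Rmax_right in H by lra. apply Goursat_rect; auto.
  - rewrite Rmin_right, Rmax_left in H by lra.
    assert (T := Goursat_rect f a b d c Hab ltac:(lra) H).
    unfold rect_int in *.
    rewrite (CRInt_swap (fun y => f (b, y)) c d) by rect_ex.
    rewrite (CRInt_swap (fun y => f (a, y)) c d) by rect_ex.
    apply (f_equal Copp) in T. rewrite Copp_0 in T. rewrite <- T. ring. }
intros H. destruct (Rle_dec a b) as [E|E]; [apply G; auto|].
rewrite Rmin_comm, Rmax_comm in H.
assert (T := G b a c d ltac:(lra) H).
rewrite Rmin_left, Rmax_right in H by lra.
assert (B : forall y, (Rmin c d <= y <= Rmax c d)%R -> ex_CRInt (fun x => f (x, y)) b a).
{ intros y Hy. apply (ex_CRInt_hor f). rewrite Rmin_left, Rmax_right by lra.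
  intros x Hx. apply H; auto. }
unfold rect_int in *.
rewrite (CRInt_swap (fun x => f (x, c)) a b)
  by (apply B; split; [apply Rmin_l|apply Rmax_l]).
rewrite (CRInt_swap (fun x => f (x, d)) a b)
  by (apply B; split; [apply Rmin_r|apply Rmax_r]).
apply (f_equal Copp) in T. rewrite Copp_0 in T. rewrite <- T. ring.
Qed.

Lemma between_abs (t y : R) : (Rmin 0 y <= t <= Rmax 0 y)%R -> (Rabs t <= Rabs y)%R.
Proof.
unfold Rmin, Rmax. destruct Rle_dec; unfold Rabs; repeat destruct Rcase_abs; lra.
Qed.

Lemma between_dist (t x y : R) : (Rmin x y <= t <= Rmax x y)%R -> (Rabs (t - x) <= Rabs (y - x))%R.
Proof.
unfold Rmin, Rmax. destruct Rle_dec; unfold Rabs; repeat destruct Rcase_abs; lra.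
Qed.

(** [F] integrates along the real axis and then vertically. Goursat's theorem turns the increment of
    [F] into an integral along a short horizontal and a short vertical segment, on which [f] is
    close to its value at the base point. *)
Theorem analytic_primitive (f : C -> C) (Hf : analytic f) :
  exists F : C -> C, F 0 = 0 /\ forall z, unit_disc z -> is_Cderive F z (f z).
Proof.
set (F := fun z : C => CRInt (fun s => f (s, 0%R)) 0 (Re z) + Ci * CRInt (fun t => f (Re z, t)) 0 (Im z)).
exists F. split.
{ unfold F; simpl. unfold CRInt. rewrite !(@RInt_point C_R_CompleteNormedModule).
  change (0 + Ci * 0 = 0). ring. }
intros [x y] Hz. unfold unit_disc in Hz.
apply is_Cderive_eps. intros eps He.
destruct (Hf _ Hz) as [l Hl].
destruct (is_Cderive_continuous f _ l Hl (eps / 2) ltac:(lra)) as [d [d0 Hd]].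
exists (Rmin d (1 - Cmod (x, y))). split; [apply Rmin_case; lra|].
intros [x' y'] Hz'.
change ((x', y') - (x, y)) with ((x' - x, y' - y)%R : C) in *.
assert (D1 := Rlt_le_trans _ _ _ Hz' (Rmin_l _ _)).
assert (D2 := Rlt_le_trans _ _ _ Hz' (Rmin_r _ _)).
assert (near : forall s t, (Rabs (s - x) <= Rabs (x' - x))%R -> (Rabs (t - y) <= Rabs (y' - y))%R ->
   unit_disc (s, t) /\ (Cmod (f (s, t) - f (x, y)) <= eps / 2)%R).
{ intros s t Hs Ht.
  assert (T := Cmod_mono _ _ _ _ Hs Ht). split.
  - unfold unit_disc. replace ((s, t) : C) with (((s - x, t - y)%R : C) + (x, y)).
    + eapply Rle_lt_trans; [apply Cmod_triangle|]. lra.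
    + unfold Cplus; simpl; f_equal; ring.
  - left. apply Hd. change ((s, t) - (x, y)) with ((s - x, t - y)%R : C). lra. }
(* The modulus is monotone in |Im|, so the vertical segment from a point of the disc to the real
   axis stays in the disc. *)
assert (down : forall s t t', (Rabs t' <= Rabs t)%R -> unit_disc (s, t) -> unit_disc (s, t')).
{ intros s t t' H1 H2. unfold unit_disc in *. eapply Rle_lt_trans; [|exact H2].
  apply Cmod_mono; auto; lra. }
assert (R0 : forall u, Rabs (u - u) = 0%R) by (intros; rewrite Rminus_diag; apply Rabs_R0).
assert (Rp : forall u, (0 <= Rabs u)%R) by (intros; apply Rabs_pos).
assert (zz' : unit_disc (x', y')) by (apply near; lra).
assert (zx' : unit_disc (x', y)) by (apply near; [lra|rewrite R0; apply Rp]).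
assert (A0 : forall u v, unit_disc (u, v) -> ex_CRInt (fun s => f (s, 0%R)) 0 u).
{ intros u v Huv. apply (ex_CRInt_hor f). intros s Hs%between_abs. apply Hf.
  unfold unit_disc in *. eapply Rle_lt_trans; [apply Cmod_mono; [exact Hs|]|exact Huv].
  rewrite Rabs_R0; apply Rp. }
assert (A1 : forall u v, unit_disc (u, v) -> ex_CRInt (fun t => f (u, t)) 0 v).
{ intros u v Huv. apply (ex_CRInt_ver f). intros s Hs%between_abs. apply Hf.
  eapply down; eassumption. }
assert (A2 : ex_CRInt (fun s => f (s, 0%R)) x x').
{ apply (ex_CRInt_hor f). intros s Hs%between_dist. apply Hf.
  apply (down s y); [rewrite Rabs_R0; apply Rp|]. apply near; auto. rewrite R0; apply Rp. }
assert (A3 : ex_CRInt (fun s => f (s, y)) x x').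
{ apply (ex_CRInt_hor f). intros s Hs%between_dist. apply Hf.
  apply near; auto. rewrite R0; apply Rp. }
assert (A4 : ex_CRInt (fun t => f (x', t)) y y').
{ apply (ex_CRInt_ver f). intros s Hs%between_dist. apply Hf.
  apply near; auto. lra. }
assert (E : F (x', y') - F (x, y) = CRInt (fun s => f (s, y)) x x' + Ci * CRInt (fun t => f (x', t)) y y').
{ unfold F; simpl.
  rewrite (CRInt_Chasles (fun s => f (s, 0%R)) 0 x x') by (auto; apply (A0 _ y); auto).
  rewrite (CRInt_Chasles (fun t => f (x', t)) 0 y y') by auto.
  (* This rectangle lifts the horizontal piece of the path from height 0 to height [y]. *)
  assert (T : rect_int f x x' 0 y = 0).
  { apply Goursat_rect_signed. intros s t Hs%between_dist Ht%between_abs.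
    apply Hf, (down s y); auto. apply near; auto. rewrite R0; apply Rp. }
  unfold rect_int in T.
  match goal with |- ?a = ?b => apply (Ceq_minus a b) end.
  rewrite <- T. ring. }
assert (K1 : CRInt (fun _ => f (x, y)) x x' = f (x, y) * (x' - x)%R).
{ unfold CRInt. rewrite (@RInt_const C_R_CompleteNormedModule).
  etransitivity; [apply scal_R_Cmult|]. apply Cmult_comm. }
assert (K2 : CRInt (fun _ => f (x, y)) y y' = f (x, y) * (y' - y)%R).
{ unfold CRInt. rewrite (@RInt_const C_R_CompleteNormedModule).
  etransitivity; [apply scal_R_Cmult|]. apply Cmult_comm. }
assert (K : forall u v, ex_CRInt (fun _ => f (x, y)) u v).
{ intros u v. apply (@ex_RInt_const C_R_NormedModule). }
assert (E' : F (x', y') - F (x, y) - f (x, y) * (x' - x, y' - y)%R =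
  CRInt (fun s => f (s, y) - f (x, y)) x x' + Ci * CRInt (fun t => f (x', t) - f (x, y)) y y').
{ rewrite !CRInt_minus by auto. rewrite K1, K2, E.
  replace ((x' - x, y' - y)%R : C) with (RtoC (x' - x) + Ci * RtoC (y' - y)).
  - ring.
  - unfold Ci, RtoC, Cplus, Cmult; simpl; f_equal; ring. }
rewrite E'.
eapply Rle_trans; [apply Cmod_triangle|]. rewrite Cmod_mult, Cmod_Ci, Rmult_1_l.
assert (B1 : (Cmod (CRInt (fun s => f (s, y) - f (x, y))%C x x') <= eps / 2 * Rabs (x' - x))%R).
{ apply CRInt_bound_abs.
  - apply ex_CRInt_minus; auto.
  - intros t Ht%between_dist. apply near; auto. rewrite R0; apply Rp. }
assert (B2 : (Cmod (CRInt (fun t => f (x', t) - f (x, y))%C y y') <= eps / 2 * Rabs (y' - y))%R).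
{ apply CRInt_bound_abs.
  - apply ex_CRInt_minus; auto.
  - intros t Ht%between_dist. apply near; auto. lra. }
(* Each of the two segments has length at most the modulus of the increment, which explains the
   choice of [eps / 2]. *)
assert (M := Rmax_Cmod (x' - x, y' - y)%R). simpl in M.
assert (M1 := Rle_trans _ _ _ (Rmax_l _ _) M).
assert (M2 := Rle_trans _ _ _ (Rmax_r _ _) M).
nra.
Qed.

(** * Cauchy's formula and regularity *)

Definition cis (t : R) : C := (cos t, sin t).

Definition circ (c : C) (rho : R) (t : R) : C := c + rho * cis t.

Lemma Cmod_cis (t : R) : Cmod (cis t) = 1%R.
Proof.
unfold Cmod, cis; simpl.
transitivity (sqrt 1); [f_equal|apply sqrt_1].
generalize (sin2_cos2 t). unfold Rsqr. lra.
Qed.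

Lemma path_derive_cis (t : R) : path_derive cis t (Ci * cis t).
Proof.
replace (Ci * cis t) with ((- sin t, cos t)%R : C)
  by (unfold Ci, cis, Cmult; simpl; f_equal; ring).
apply path_derive_pair; [apply is_derive_cos|apply is_derive_sin].
Qed.

Lemma is_Cderive_affine (c0 c1 z : C) : is_Cderive (fun z => c0 + c1 * z) z c1.
Proof.
apply (is_Cderive_eq _ _ _ (0 + (0 * z + c1 * 1))); [|ring].
apply (is_Cderive_plus (fun _ => c0) (fun z => c1 * z)); [apply is_Cderive_const|].
apply (is_Cderive_mult (fun _ => c1) (fun z => z)); [apply is_Cderive_const|apply is_Cderive_id].
Qed.

Lemma path_derive_affine (c0 c1 : C) (phi : R -> C) (t : R) (d : C) :
  path_derive phi t d -> path_derive (fun s => c0 + c1 * phi s) t (c1 * d).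
Proof. apply (path_derive_comp (fun z => c0 + c1 * z)), is_Cderive_affine. Qed.

Lemma path_derive_circ (c : C) (rho t : R) : path_derive (circ c rho) t (rho * (Ci * cis t)).
Proof. apply (path_derive_affine c rho cis), path_derive_cis. Qed.

Lemma path_derive_RtoC (t : R) : path_derive RtoC t 1.
Proof. apply (path_derive_hor 0). Qed.

(** Componentwise, to match the real integrand that is differentiated under the integral sign in
    [circle_homotopy_re]. *)
Definition cont_2d (w : R -> R -> C) (x y : R) : Prop :=
  continuity_2d_pt (fun u v => Re (w u v)) x y /\ continuity_2d_pt (fun u v => Im (w u v)) x y.

Lemma cont_2d_mult (w1 w2 : R -> R -> C) (x y : R) :
  cont_2d w1 x y -> cont_2d w2 x y -> cont_2d (fun u v => w1 u v * w2 u v) x y.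
Proof.
intros [A1 A2] [B1 B2]. split; simpl.
- apply continuity_2d_pt_minus; apply continuity_2d_pt_mult; assumption.
- apply continuity_2d_pt_plus; apply continuity_2d_pt_mult; assumption.
Qed.

Lemma cont_2d_plus (w1 w2 : R -> R -> C) (x y : R) :
  cont_2d w1 x y -> cont_2d w2 x y -> cont_2d (fun u v => w1 u v + w2 u v) x y.
Proof.
intros [A1 A2] [B1 B2]. split; simpl; apply continuity_2d_pt_plus; assumption.
Qed.

Lemma cont_2d_const (c : C) (x y : R) : cont_2d (fun _ _ => c) x y.
Proof. split; apply continuity_2d_pt_const. Qed.

Lemma Rabs_im_le_Cmod (z : C) : (Rabs (Im z) <= Cmod z)%R.
Proof. eapply Rle_trans; [|apply Rmax_Cmod]. apply Rmax_r. Qed.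

Lemma cont_2d_fst (phi : R -> C) (x y : R) : path_cont phi x -> cont_2d (fun u _ => phi u) x y.
Proof.
intros H. split; intros eps; destruct (H eps (cond_pos eps)) as [d [d0 Hd]];
  exists (mkposreal d d0); intros u v Hu Hv; specialize (Hd u Hu).
- eapply Rle_lt_trans; [|exact Hd]. apply (re_le_Cmod (phi u - phi x)).
- eapply Rle_lt_trans; [|exact Hd]. apply (Rabs_im_le_Cmod (phi u - phi x)).
Qed.

Lemma cont_2d_snd (phi : R -> C) (x y : R) : path_cont phi y -> cont_2d (fun _ v => phi v) x y.
Proof.
intros H. split; intros eps; destruct (H eps (cond_pos eps)) as [d [d0 Hd]];
  exists (mkposreal d d0); intros u v Hu Hv; specialize (Hd v Hv).
- eapply Rle_lt_trans; [|exact Hd]. apply (re_le_Cmod (phi v - phi y)).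
- eapply Rle_lt_trans; [|exact Hd]. apply (Rabs_im_le_Cmod (phi v - phi y)).
Qed.

Lemma cont_2d_comp (g : C -> C) (w : R -> R -> C) (x y : R) :
  ex_Cderive g (w x y) -> cont_2d w x y -> cont_2d (fun u v => g (w u v)) x y.
Proof.
intros [l Hl] [H1 H2].
assert (K : forall eps : posreal, exists d : posreal, forall u v,
   (Rabs (u - x) < d)%R -> (Rabs (v - y) < d)%R -> (Cmod (g (w u v) - g (w x y)) < eps)%R).
{ intros eps. destruct (is_Cderive_continuous g _ l Hl eps (cond_pos eps)) as [d [d0 Hd]].
  assert (d1 : (0 < d / 2)%R) by lra.
  destruct (H1 (mkposreal _ d1)) as [r1 Hr1]. destruct (H2 (mkposreal _ d1)) as [r2 Hr2].
  assert (r0 : (0 < Rmin r1 r2)%R) by (apply Rmin_case; apply cond_pos).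
  exists (mkposreal _ r0). simpl. intros u v Hu Hv. apply Hd.
  specialize (Hr1 u v (Rlt_le_trans _ _ _ Hu (Rmin_l _ _)) (Rlt_le_trans _ _ _ Hv (Rmin_l _ _))).
  specialize (Hr2 u v (Rlt_le_trans _ _ _ Hu (Rmin_r _ _)) (Rlt_le_trans _ _ _ Hv (Rmin_r _ _))).
  simpl in Hr1, Hr2.
  eapply Rle_lt_trans; [apply (Cmod_pair_le (Re (w u v) - Re (w x y)) (Im (w u v) - Im (w x y)))|].
  lra. }
split; intros eps; destruct (K eps) as [d Hd]; exists d; intros u v Hu Hv; specialize (Hd u v Hu Hv).
- eapply Rle_lt_trans; [|exact Hd]. apply (re_le_Cmod (g (w u v) - g (w x y))).
- eapply Rle_lt_trans; [|exact Hd]. apply (Rabs_im_le_Cmod (g (w u v) - g (w x y))).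
Qed.

Lemma CRInt_re (phi : R -> C) (a b : R) : ex_CRInt phi a b ->
  is_RInt (fun t => Re (phi t)) a b (Re (CRInt phi a b)).
Proof.
intros H.
apply (is_RInt_fct_extend_fst (U := R_NormedModule) (V := R_NormedModule) phi a b).
apply CRInt_correct, H.
Qed.

Lemma CRInt_im (phi : R -> C) (a b : R) : ex_CRInt phi a b ->
  is_RInt (fun t => Im (phi t)) a b (Im (CRInt phi a b)).
Proof.
intros H.
apply (is_RInt_fct_extend_snd (U := R_NormedModule) (V := R_NormedModule) phi a b).
apply CRInt_correct, H.
Qed.

Lemma path_cont_mult (phi psi : R -> C) (t : R) : path_cont phi t -> path_cont psi t ->
  path_cont (fun s => phi s * psi s) t.
Proof.
intros H1 H2 eps He.
set (A := (Cmod (phi t) + 1)%R). set (B := (Cmod (psi t) + 1)%R).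
assert (A0 : (1 <= A)%R) by (unfold A; generalize (Cmod_ge_0 (phi t)); lra).
assert (B0 : (1 <= B)%R) by (unfold B; generalize (Cmod_ge_0 (psi t)); lra).
set (e := Rmin 1 (eps / (A + B))).
assert (e0 : (0 < e)%R) by (apply Rmin_case; [lra|apply Rdiv_lt_0_compat; lra]).
destruct (H1 e e0) as [d1 [p1 D1]]. destruct (H2 e e0) as [d2 [p2 D2]].
exists (Rmin d1 d2). split; [apply Rmin_case; auto|]. intros s Hs.
specialize (D1 s (Rlt_le_trans _ _ _ Hs (Rmin_l _ _))).
specialize (D2 s (Rlt_le_trans _ _ _ Hs (Rmin_r _ _))).
replace (phi s * psi s - phi t * psi t) with
  ((phi s - phi t) * (psi s - psi t) + (phi s - phi t) * psi t + phi t * (psi s - psi t)) by ring.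
eapply Rle_lt_trans; [apply Cmod_triangle|].
eapply Rle_lt_trans; [apply Rplus_le_compat_r, Cmod_triangle|].
rewrite !Cmod_mult.
assert (E1 : (e <= 1)%R) by apply Rmin_l.
assert (E2 : (e * (A + B) <= eps)%R).
{ apply Rle_trans with (eps / (A + B) * (A + B))%R; [|right; field; lra].
  apply Rmult_le_compat_r; [lra|apply Rmin_r]. }
assert (P1 := Cmod_ge_0 (phi s - phi t)). assert (P2 := Cmod_ge_0 (psi s - psi t)).
assert (P3 := Cmod_ge_0 (phi t)). assert (P4 := Cmod_ge_0 (psi t)).
unfold A, B in *.
assert (Q1 : (Cmod (phi s - phi t) * Cmod (psi s - psi t) <= e * 1)%R) by (apply Rmult_le_compat; lra).
assert (Q2 : (Cmod (phi s - phi t) * Cmod (psi t) <= e * Cmod (psi t))%R) by (apply Rmult_le_compat_r; lra).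
assert (Q3 : (Cmod (phi t) * Cmod (psi s - psi t) <= Cmod (phi t) * e)%R) by (apply Rmult_le_compat_l; lra).
lra.
Qed.

Lemma path_cont_const (c : C) (t : R) : path_cont (fun _ => c) t.
Proof.
intros eps He. exists 1%R. split; [lra|]. intros s _.
replace (c - c) with (RtoC 0) by ring. rewrite Cmod_0. exact He.
Qed.

Lemma path_cont_cis (t : R) : path_cont cis t.
Proof. eapply path_derive_cont, path_derive_cis. Qed.

Lemma path_cont_circ (c : C) (rho t : R) : path_cont (circ c rho) t.
Proof. eapply path_derive_cont, path_derive_circ. Qed.

Lemma circ_neq (c a : C) (rho t : R) : (Cmod (a - c) < rho)%R -> circ c rho t - a <> 0.
Proof.
intros H E. apply (Rlt_irrefl rho). eapply Rle_lt_trans; [|exact H].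
replace (a - c) with (rho * cis t - (circ c rho t - a)) by (unfold circ; ring).
rewrite E. replace (rho * cis t - 0) with (rho * cis t) by ring.
rewrite Cmod_mult, Cmod_cis, Cmod_R, Rmult_1_r. apply Rle_abs.
Qed.

(** This is d zeta / (zeta - a) on the circle, divided by i dt; the usual 2 PI i thus becomes 2
    PI. *)
Definition ckern (c a : C) (rho t : R) : C := rho * cis t / (circ c rho t - a).

Lemma path_cont_ckern (c a : C) (rho t : R) : (Cmod (a - c) < rho)%R ->
  path_cont (ckern c a rho) t.
Proof.
intros H. unfold ckern, Cdiv. apply path_cont_mult.
- apply (path_cont_mult (fun _ => RtoC rho)); [apply path_cont_const|apply path_cont_cis].
- apply (path_cont_comp (fun z => / (z - a)) (circ c rho)); [|apply path_cont_circ].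
  eexists. apply (is_Cderive_comp Cinv (fun z => z - a)).
  + apply is_Cderive_inv_id. apply circ_neq, H.
  + apply (is_Cderive_minus (fun z => z) (fun _ => a)); [apply is_Cderive_id|apply is_Cderive_const].
Qed.

(** The parameter may leave [0, 1] on both sides, so that the integral can be differentiated in [u]
    at the ends too. The margin d is chosen so that rho (1 + 2 d) = R0, while |1 - u| + |u| < 1 + 2
    d. *)
Lemma homotopy_in_disc (c a : C) (rho R0 u v : R) : (Cmod (a - c) < rho)%R -> (rho < R0)%R ->
  (- ((R0 - rho) / (2 * rho)) < u < 1 + (R0 - rho) / (2 * rho))%R ->
  (Cmod (a + u * (circ c rho v - a) - c) < R0)%R.
Proof.
intros H1 H2 Hu. assert (P := Cmod_ge_0 (a - c)).
set (d := ((R0 - rho) / (2 * rho))%R) in *.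
assert (Ed : (R0 = rho + 2 * d * rho)%R) by (unfold d; field; lra).
assert (d0 : (0 < d)%R) by (apply Rdiv_lt_0_compat; lra).
replace (a + u * (circ c rho v - a) - c) with (RtoC (1 - u) * (a - c) + RtoC u * (rho * cis v))
  by (unfold circ; rewrite RtoC_minus; ring).
eapply Rle_lt_trans; [apply Cmod_triangle|].
rewrite !Cmod_mult, !Cmod_R, Cmod_cis, (Rabs_right rho) by lra.
assert (Q : (Rabs (1 - u) * Cmod (a - c) <= Rabs (1 - u) * rho)%R)
  by (apply Rmult_le_compat_l; [apply Rabs_pos|lra]).
rewrite Ed. assert (Q2 : (Rabs (1 - u) + Rabs u < 1 + 2 * d)%R)
  by (unfold Rabs; repeat destruct Rcase_abs; lra).
nra.
Qed.

(* The integral over the contracted circle [a + u (zeta - a)] has [u]-derivative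
   [int Re (g (a + u (zeta - a)) rho e^(i v)) dv], whose integrand is [1/u] times the
   [v]-derivative of [Im G (a + u (zeta - a))]. *)
Lemma circle_homotopy_re (G g : C -> C) (c a : C) (rho R0 : R) :
  (Cmod (a - c) < rho)%R -> (rho < R0)%R ->
  (forall z, (Cmod (z - c) < R0)%R -> is_Cderive G z (g z)) ->
  (forall z, (Cmod (z - c) < R0)%R -> ex_Cderive g z) ->
  RInt (fun t => Re (G (circ c rho t) * ckern c a rho t)) 0 (2 * PI) =
  RInt (fun t => Re (G a * ckern c a rho t)) 0 (2 * PI).
Proof.
intros H1 H2 HG Hg. assert (P := Cmod_ge_0 (a - c)).
set (d := ((R0 - rho) / (2 * rho))%R).
assert (d0 : (0 < d)%R) by (apply Rdiv_lt_0_compat; lra).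
assert (In : forall u v, (- d < u < 1 + d)%R -> (Cmod (a + u * (circ c rho v - a) - c) < R0)%R)
  by (intros; apply homotopy_in_disc; auto).
set (m := fun u v => Re (G (a + RtoC u * (circ c rho v - a)) * ckern c a rho v)).
set (dm := fun u v => Re (g (a + RtoC u * (circ c rho v - a)) * (rho * cis v))).
assert (Dm : forall u v, (- d < u < 1 + d)%R -> is_derive (fun u => m u v) u (dm u v)).
{ intros u v Hu. unfold m, dm.
  (* The factor zeta - a from the chain rule cancels the denominator of the kernel. *)
  replace (g (a + RtoC u * (circ c rho v - a)) * (rho * cis v)) with
   (ckern c a rho v * (g (a + RtoC u * (circ c rho v - a)) * ((circ c rho v - a) * 1))).
  2:{ unfold ckern. field. apply circ_neq; auto. }
  apply path_derive_re.
  assert (T : path_derive (fun s => a + (circ c rho v - a) * RtoC s) u ((circ c rho v - a) * 1))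
    by (apply (path_derive_affine a (circ c rho v - a) RtoC), path_derive_RtoC).
  apply (path_derive_comp (fun z => z * ckern c a rho v)
     (fun s => G (a + RtoC s * (circ c rho v - a)))).
  - apply (is_Cderive_eq _ _ _ (1 * ckern c a rho v + G (a + u * (circ c rho v - a)) * 0)); [|ring].
    apply (is_Cderive_mult (fun z => z) (fun _ => ckern c a rho v)); [apply is_Cderive_id|apply is_Cderive_const].
  - apply (path_derive_comp G (fun s => a + RtoC s * (circ c rho v - a))).
    + apply HG, In, Hu.
    + unfold path_derive in *. eapply (@is_derive_ext R_AbsRing C_R_NormedModule); [|exact T].
      intros s. simpl. f_equal. apply Cmult_comm. }
assert (loc : forall u, (- d < u < 1 + d)%R -> locally u (fun y => (- d < y < 1 + d)%R)).
{ intros u Hu. assert (e0 : (0 < Rmin (u + d) (1 + d - u))%R) by (apply Rmin_case; lra).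
  exists (mkposreal _ e0). intros y Hy.
  assert (T1 := Rlt_le_trans _ _ _ Hy (Rmin_l _ _)).
  assert (T2 := Rlt_le_trans _ _ _ Hy (Rmin_r _ _)).
  unfold abs, minus, plus, opp in T1, T2; simpl in T1, T2.
  apply Rabs_def2 in T1, T2. lra. }
assert (Ex : forall u, (- d < u < 1 + d)%R -> ex_RInt (fun v => m u v) 0 (2 * PI)).
{ intros u Hu. eexists. apply CRInt_re. apply ex_CRInt_cont. intros t _.
  apply path_cont_mult; [|apply path_cont_ckern; auto].
  apply (path_cont_comp G (fun s => a + RtoC u * (circ c rho s - a))).
  - eexists; apply HG, In, Hu.
  - apply (path_cont_comp (fun z => a + RtoC u * (z - a)) (circ c rho)); [|apply path_cont_circ].
    eexists. apply (is_Cderive_comp (fun z => a + u * z) (fun z => z - a)).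
    + apply is_Cderive_affine.
    + apply (is_Cderive_minus (fun z => z) (fun _ => a)); [apply is_Cderive_id|apply is_Cderive_const]. }
assert (DM : forall u, (- d < u < 1 + d)%R ->
   is_derive (fun u => RInt (m u) 0 (2 * PI)) u (RInt (dm u) 0 (2 * PI))).
{ intros u Hu.
  replace (RInt (dm u) 0 (2 * PI)) with (RInt (fun v => Derive (fun x => m x v) u) 0 (2 * PI)).
  2:{ apply RInt_ext. intros v _. apply is_derive_unique, Dm, Hu. }
  apply is_derive_RInt_param.
  - apply (filter_imp (fun y => (- d < y < 1 + d)%R)); [|apply loc, Hu].
    intros y Hy v _. eexists; apply Dm, Hy.
  - intros v _. apply (continuity_2d_pt_ext_loc dm).
    + destruct (loc u Hu) as [e He]. exists e. intros y w Hy _. symmetry.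
      apply is_derive_unique, Dm. apply He. exact Hy.
    + assert (T : cont_2d (fun u v => g (a + RtoC u * (circ c rho v - a)) * (rho * cis v)) u v).
      { apply cont_2d_mult.
        - apply (cont_2d_comp g (fun u v => a + RtoC u * (circ c rho v - a))).
          + apply Hg, In, Hu.
          + apply cont_2d_plus; [apply cont_2d_const|].
            apply cont_2d_mult.
            * apply (cont_2d_fst RtoC). eapply path_derive_cont, path_derive_RtoC.
            * apply (cont_2d_plus (fun _ v => circ c rho v) (fun _ _ => - a)); [|apply cont_2d_const].
              apply (cont_2d_snd (circ c rho)), path_cont_circ.
        - apply (cont_2d_mult (fun _ _ => RtoC rho) (fun _ v => cis v)); [apply cont_2d_const|].
          apply (cont_2d_snd cis), path_cont_cis. }
      apply T.
  - apply (filter_imp (fun y => (- d < y < 1 + d)%R)); [|apply loc, Hu]. exact Ex. }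
assert (Z : forall u, (0 < u < 1)%R -> RInt (dm u) 0 (2 * PI) = 0%R).
{ intros u Hu.
  set (q := fun v => (/ u * Im (G (a + RtoC u * (circ c rho v - a))%C))%R).
  assert (Dp : forall v, path_derive (fun v => a + RtoC u * (circ c rho v - a)) v (RtoC u * (rho * (Ci * cis v)))).
  { intros v. unfold path_derive.
    apply (@is_derive_ext R_AbsRing C_R_NormedModule (fun v => (a - RtoC u * a) + RtoC u * circ c rho v)).
    - intros t. match goal with |- ?x = ?y => change (@eq C x y) end. ring.
    - apply (path_derive_affine (a - RtoC u * a) u (circ c rho)), path_derive_circ. }
  assert (Dq : forall v, is_derive q v (dm u v)).
  { intros v. unfold q.
    assert (T := path_derive_im _ _ _ (path_derive_comp G _ v _ _ (HG _ (In u v ltac:(lra))) (Dp v))).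
    apply (is_derive_scal _ v (/ u)) in T.
    eapply eq_rect with (P := fun l => is_derive _ v l); [exact T|].
    unfold dm. set (w := g _).
    replace (w * (u * (rho * (Ci * cis v)))) with (u * (Ci * (w * (rho * cis v)))) by ring.
    rewrite im_scal_l, im_mult. simpl. field. lra. }
  assert (T : is_RInt (dm u) 0 (2 * PI) (minus (q (2 * PI)%R) (q 0%R))).
  { apply (@is_RInt_derive R_CompleteNormedModule q (dm u)).
    - intros v _. apply Dq.
    - intros v _. apply continuity_pt_filterlim.
      assert (T : path_cont (fun v => g (a + RtoC u * (circ c rho v - a)) * (rho * cis v)) v).
      { apply path_cont_mult.
        - apply (path_cont_comp g (fun v => a + RtoC u * (circ c rho v - a))).
          + apply Hg, In; lra.
          + eapply path_derive_cont, Dp.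
        - apply (path_cont_mult (fun _ => RtoC rho)); [apply path_cont_const|apply path_cont_cis]. }
      intros eps Heps. destruct (T eps Heps) as [r [r0 Hr]].
      exists r. split; [exact r0|]. intros s [_ Hs].
      eapply Rle_lt_trans; [|apply (Hr s Hs)].
      apply (re_le_Cmod (_ - _)). }
  rewrite (is_RInt_unique _ _ _ _ T). unfold q, circ, cis.
  rewrite cos_2PI, sin_2PI, cos_0, sin_0. unfold minus, plus, opp; simpl. ring. }
(* [Z] divides by [u] and so gives a vanishing derivative only inside (0, 1); the mean value theorem
   asks no more than that, together with continuity at the ends. At u = 1 the integrand is that of
   the left side, at u = 0 that of the right side. *)
destruct (MVT_gen (fun u => RInt (m u) 0 (2 * PI)) 0 1 (fun _ => 0%R)) as [x [_ Hx]].
- rewrite Rmin_left, Rmax_right by lra. intros u Hu.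
  assert (T := DM u ltac:(lra)). rewrite (Z u Hu) in T. exact T.
- rewrite Rmin_left, Rmax_right by lra. intros u Hu.
  apply continuity_pt_filterlim.
  apply (@ex_derive_continuous R_AbsRing R_NormedModule (fun u => RInt (m u) 0 (2 * PI))).
  exists (RInt (dm u) 0 (2 * PI)). apply DM; lra.
- rewrite Rmult_0_l in Hx. apply Rminus_diag_uniq in Hx.
  transitivity (RInt (m 1%R) 0 (2 * PI)); [|rewrite Hx]; apply RInt_ext; intros t _; unfold m;
    do 3 f_equal; ring.
Qed.

Lemma RtoC_neq_0 (x : R) : x <> 0%R -> RtoC x <> 0.
Proof. intros H E. apply H. apply RtoC_inj, E. Qed.

Lemma C_eq_intro (z w : C) : Re z = Re w -> Im z = Im w -> z = w.
Proof. destruct z, w; simpl; intros -> ->; reflexivity. Qed.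

(** The imaginary part is the real part for the function - i G. *)
Lemma circle_homotopy (G g : C -> C) (c a : C) (rho R0 : R) :
  (Cmod (a - c) < rho)%R -> (rho < R0)%R ->
  (forall z, (Cmod (z - c) < R0)%R -> is_Cderive G z (g z)) ->
  (forall z, (Cmod (z - c) < R0)%R -> ex_Cderive g z) ->
  CRInt (fun t => G (circ c rho t) * ckern c a rho t) 0 (2 * PI) =
  G a * CRInt (ckern c a rho) 0 (2 * PI).
Proof.
intros H1 H2 HG Hg.
assert (P := Cmod_ge_0 (a - c)).
assert (Ex2 : ex_CRInt (ckern c a rho) 0 (2 * PI))
  by (apply ex_CRInt_cont; intros; apply path_cont_ckern; auto).
assert (Ex1 : ex_CRInt (fun t => G (circ c rho t) * ckern c a rho t) 0 (2 * PI)).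
{ apply ex_CRInt_cont; intros t _. apply path_cont_mult; [|apply path_cont_ckern; auto].
  apply path_cont_comp; [|apply path_cont_circ]. eexists; apply HG.
  unfold circ. replace (c + rho * cis t - c) with (rho * cis t) by ring.
  rewrite Cmod_mult, Cmod_R, Cmod_cis, Rabs_right; lra. }
rewrite <- CRInt_scal by exact Ex2.
assert (Ex3 := ex_CRInt_scal (G a) _ _ _ Ex2).
assert (T1 := circle_homotopy_re G g c a rho R0 H1 H2 HG Hg).
assert (T2 := circle_homotopy_re (fun z => - Ci * G z) (fun z => - Ci * g z) c a rho R0 H1 H2).
apply C_eq_intro.
- rewrite (is_RInt_unique _ _ _ _ (CRInt_re _ _ _ Ex1)) in T1.
  rewrite (is_RInt_unique _ _ _ _ (CRInt_re _ _ _ Ex3)) in T1. exact T1.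
- assert (E : forall z w, Re (- Ci * z * w) = Im (z * w)) by (intros; simpl; ring).
  rewrite <- (is_RInt_unique _ _ _ _ (CRInt_im _ _ _ Ex1)).
  rewrite <- (is_RInt_unique _ _ _ _ (CRInt_im _ _ _ Ex3)).
  etransitivity; [|etransitivity; [apply T2|]].
  + apply RInt_ext. intros t _. symmetry; apply E.
  + intros z Hz. apply (is_Cderive_eq _ _ _ (0 * G z + - Ci * g z)); [|ring].
    apply (is_Cderive_mult (fun _ => - Ci) G); [apply is_Cderive_const|auto].
  + intros z Hz. destruct (Hg z Hz) as [l Hl]. exists (0 * g z + - Ci * l).
    apply (is_Cderive_mult (fun _ => - Ci) g); [apply is_Cderive_const|auto].
  + apply RInt_ext. intros t _. apply E.
Qed.

Lemma CRInt_const (z : C) (a b : R) : CRInt (fun _ => z) a b = RtoC (b - a) * z.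
Proof.
unfold CRInt. rewrite (@RInt_const C_R_CompleteNormedModule). apply scal_R_Cmult.
Qed.

(** With pole and centre both at 0 the kernel is constantly 1, so its integral is immediate. The
    general kernel integral [CRInt_ckern] is deduced from this case. *)
Lemma circle_mean (G g : C -> C) (R0 : R) : (1 < R0)%R ->
  (forall z, (Cmod z < R0)%R -> is_Cderive G z (g z)) ->
  (forall z, (Cmod z < R0)%R -> ex_Cderive g z) ->
  CRInt (fun t => G (cis t)) 0 (2 * PI) = RtoC (2 * PI) * G 0.
Proof.
intros H HG Hg.
assert (K : forall t, ckern 0 0 1 t = 1).
{ intros t. unfold ckern, circ. field. intros E.
  assert (T := Cmod_cis t). rewrite E, Cmod_0 in T. lra. }
assert (T := circle_homotopy G g 0 0 1 R0).
replace (CRInt (ckern 0 0 1) 0 (2 * PI)) with (RtoC (2 * PI)) in T.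
- rewrite (Cmult_comm (RtoC _)), <- T; clear T.
  + apply CRInt_ext. intros t _. rewrite K, Cmult_1_r. unfold circ. f_equal. ring.
  + replace (0 - 0) with (RtoC 0) by ring. rewrite Cmod_0. lra.
  + exact H.
  + intros z Hz. apply HG. replace (z - 0) with z in Hz by ring. exact Hz.
  + intros z Hz. apply Hg. replace (z - 0) with z in Hz by ring. exact Hz.
- rewrite (CRInt_ext _ (fun _ => 1)) by (intros; apply K).
  rewrite CRInt_const, Rminus_0_r. ring.
Qed.

Lemma CRInt_conj (phi : R -> C) (a b : R) : ex_CRInt phi a b ->
  CRInt (fun t => Cconj (phi t)) a b = Cconj (CRInt phi a b).
Proof.
intros H. apply CRInt_unique.
apply (is_RInt_fct_extend_pair (U := R_NormedModule) (V := R_NormedModule)); simpl.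
- apply CRInt_re, H.
- apply (@is_RInt_opp R_NormedModule). apply CRInt_im, H.
Qed.

Lemma Cinv_linear_derive (b z : C) : 1 - b * z <> 0 ->
  is_Cderive (fun z => / (1 - b * z)) z (b * / (1 - b * z) * / (1 - b * z)).
Proof.
intros H.
apply (is_Cderive_eq _ _ _ (- b * - / ((1 - b * z) * (1 - b * z)))); [|field; exact H].
apply (is_Cderive_comp Cinv (fun z => 1 - b * z)).
- apply is_Cderive_inv_id, H.
- apply (is_Cderive_eq _ _ _ (0 - (0 * z + b * 1))); [|ring].
  apply (is_Cderive_minus (fun _ => 1) (fun z => b * z)); [apply is_Cderive_const|].
  apply (is_Cderive_mult (fun _ => b) (fun z => z)); [apply is_Cderive_const|apply is_Cderive_id].
Qed.

Lemma one_minus_neq_0 (w : C) : (Cmod w < 1)%R -> 1 - w <> 0.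
Proof.
intros H E. replace w with (1 - (1 - w)) in H by ring.
rewrite E in H. replace (1 - 0) with (RtoC 1) in H by ring.
rewrite Cmod_1 in H. lra.
Qed.

(* The conjugate of the kernel is [1 / (1 - b e^(i t))] with [|b| < 1], to which the mean value
   property applies. *)
Lemma CRInt_ckern (c a : C) (rho : R) : (Cmod (a - c) < rho)%R ->
  CRInt (ckern c a rho) 0 (2 * PI) = RtoC (2 * PI).
Proof.
intros H. assert (P := Cmod_ge_0 (a - c)).
assert (Hr : RtoC rho <> 0) by (apply RtoC_neq_0; lra).
set (b := Cconj (a - c) / rho).
assert (Hb : Cmod b = (Cmod (a - c) / rho)%R).
{ unfold b. rewrite Cmod_div, Cmod_conj, Cmod_R, Rabs_right by (auto; lra). reflexivity. }
assert (b1 : (0 <= Cmod b < 1)%R).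
{ split; [apply Cmod_ge_0|]. rewrite Hb. apply Rlt_div_l; lra. }
(* A radius above 1 with |b| R0 < 1; unlike a choice based on 1 / |b|, it also makes sense for b =
   0. *)
set (R0 := (2 / (1 + Cmod b))%R).
assert (HR : (1 < R0)%R) by (apply Rlt_div_r; lra).
assert (Hin : forall z, (Cmod z < R0)%R -> 1 - b * z <> 0).
{ intros z Hz. apply one_minus_neq_0. rewrite Cmod_mult.
  assert (E : (R0 * (1 + Cmod b) = 2)%R) by (unfold R0; field; lra).
  generalize (Cmod_ge_0 z). nra. }
assert (T := circle_mean (fun z => / (1 - b * z)) (fun z => b * / (1 - b * z) * / (1 - b * z)) R0 HR).
assert (E : forall t, ckern c a rho t = Cconj (/ (1 - b * cis t))).
{ intros t.
  assert (N : 1 - b * cis t <> 0) by (apply Hin; rewrite Cmod_cis; exact HR).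
  rewrite Cinv_conj by exact N.
  rewrite Cminus_conj, Cmult_conj. unfold b. rewrite Cdiv_conj, Cconj_conj by exact Hr.
  assert (CC : Cconj (RtoC rho) = rho) by (unfold Cconj, RtoC; simpl; f_equal; ring).
  assert (C1 : Cconj 1 = 1) by (unfold Cconj, RtoC; simpl; f_equal; ring).
  rewrite CC, C1.
  assert (cc : cis t * Cconj (cis t) = 1).
  { rewrite <- Cmod2_conj, Cmod_cis. rewrite pow1. reflexivity. }
  assert (N1 := circ_neq c a rho t H).
  unfold ckern.
  assert (N2 : cis t <> 0).
  { intros E. rewrite E, Cmult_0_l in cc. apply RtoC_inj in cc. lra. }
  replace (Cconj (cis t)) with (/ cis t).
  2:{ apply (f_equal (fun z => / cis t * z)) in cc. rewrite Cmult_assoc, Cinv_l, Cmult_1_l, Cmult_1_r in cc by exact N2. auto. }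
  unfold circ in *. field. repeat split; auto.
  intros E; apply N1. rewrite <- E. ring. }
rewrite (CRInt_ext _ (fun t => Cconj (/ (1 - b * cis t)))) by (intros; apply E).
rewrite CRInt_conj.
- rewrite T.
  + replace (1 - b * 0) with (RtoC 1) by ring.
    rewrite Cmult_conj. unfold Cconj, RtoC, Cmult, Cinv; simpl; f_equal; field.
  + intros z Hz. apply Cinv_linear_derive, Hin, Hz.
  + intros z Hz. eexists.
    apply (is_Cderive_mult (fun z => b * / (1 - b * z)) (fun z => / (1 - b * z))).
    * apply (is_Cderive_mult (fun _ => b) (fun z => / (1 - b * z))); [apply is_Cderive_const|].
      apply Cinv_linear_derive, Hin, Hz.
    * apply Cinv_linear_derive, Hin, Hz.
- apply ex_CRInt_cont. intros t _.
  apply (path_cont_comp (fun z => / (1 - b * z)) cis); [|apply path_cont_cis].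
  eexists. apply Cinv_linear_derive, Hin. rewrite Cmod_cis; exact HR.
Qed.

Theorem Cauchy_formula (G g : C -> C) (c a : C) (rho R0 : R) :
  (Cmod (a - c) < rho)%R -> (rho < R0)%R ->
  (forall z, (Cmod (z - c) < R0)%R -> is_Cderive G z (g z)) ->
  (forall z, (Cmod (z - c) < R0)%R -> ex_Cderive g z) ->
  CRInt (fun t => G (circ c rho t) * ckern c a rho t) 0 (2 * PI) = RtoC (2 * PI) * G a.
Proof.
intros H1 H2 HG Hg. rewrite (circle_homotopy G g c a rho R0), CRInt_ckern; auto. ring.
Qed.

(** * Integrals of Cauchy type and regularity *)

Lemma circ_dist (c w : C) (rho t : R) : (0 <= rho)%R ->
  (rho - Cmod (w - c) <= Cmod (circ c rho t - w))%R.
Proof.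
intros H. unfold circ.
assert (T := Cmod_triangle (c + rho * cis t - w) (w - c)).
replace (c + rho * cis t - w + (w - c)) with (rho * cis t) in T by ring.
rewrite Cmod_mult, Cmod_R, Cmod_cis, Rabs_right in T by lra. lra.
Qed.

(** A free density and a free exponent make the family stable under differentiation in [w]: each
    derivative raises [n] by one and leaves [phi] alone. *)
Definition Cauchy_int (phi : R -> C) (c : C) (rho : R) (n : nat) (w : C) : C :=
  CRInt (fun t => phi t * / (circ c rho t - w) ^ n) 0 (2 * PI).

Lemma path_cont_Cauchy (phi : R -> C) (c w : C) (rho : R) (n : nat) (t : R) :
  (Cmod (w - c) < rho)%R -> path_cont phi t ->
  path_cont (fun t => phi t * / (circ c rho t - w) ^ n) t.
Proof.
intros Hw Hphi. apply path_cont_mult; [exact Hphi|].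
assert (K : path_cont (fun t => / (circ c rho t - w)) t).
{ apply (path_cont_comp (fun z => / (z - w)) (circ c rho)); [|apply path_cont_circ].
  eexists. apply (is_Cderive_comp Cinv (fun z => z - w)).
  + apply is_Cderive_inv_id. apply circ_neq, Hw.
  + apply (is_Cderive_minus (fun z => z) (fun _ => w)); [apply is_Cderive_id|apply is_Cderive_const]. }
apply (path_cont_ext (fun t => (/ (circ c rho t - w)) ^ n)).
{ intros s. apply Cpow_inv, circ_neq, Hw. }
induction n as [|n IH].
- apply (path_cont_const 1).
- apply (path_cont_ext (fun t => / (circ c rho t - w) * (/ (circ c rho t - w)) ^ n)).
  + intros s. rewrite Cpow_S. reflexivity.
  + apply path_cont_mult; auto.
Qed.

Lemma path_cont_bounded (phi : R -> C) (a b : R) : (a <= b)%R -> (forall t, path_cont phi t) ->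
  exists M : R, forall t, (a <= t <= b)%R -> (Cmod (phi t) <= M)%R.
Proof.
intros Hab H.
destruct (continuity_ab_maj (fun t => Cmod (phi t)) a b Hab) as [m [Hm _]].
- intros t _ eps Heps. destruct (H t eps Heps) as [d [d0 Hd]].
  exists d; split; [exact d0|]. intros s [_ Hs]. specialize (Hd s Hs).
  eapply Rle_lt_trans; [|exact Hd].
  change (Rabs (Cmod (phi s) - Cmod (phi t)) <= Cmod (phi s - phi t))%R.
  assert (T1 := Cmod_triangle (phi s - phi t) (phi t)).
  assert (T2 := Cmod_triangle (phi t - phi s) (phi s)).
  replace (phi s - phi t + phi t) with (phi s) in T1 by ring.
  replace (phi t - phi s + phi s) with (phi t) in T2 by ring.
  rewrite <- (Cmod_opp (phi t - phi s)), Copp_minus_distr in T2.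
  apply Rabs_le. lra.
- exists (Cmod (phi m)). exact Hm.
Qed.

(** First-order expansion of u^-n with a constant depending only on [N] and [n], so that it can be
    integrated around the circle. The induction multiplies by 1 / (u - h) and uses 1 / (u - h) = 1 /
    u + h / (u (u - h)). *)
Lemma inv_pow_taylor (N : R) (n : nat) : (0 <= N)%R -> exists K : R, (0 <= K)%R /\
  forall u h : C, u <> 0 -> u - h <> 0 -> (Cmod (/ u) <= N)%R -> (Cmod (/ (u - h)) <= N)%R ->
  (Cmod ((/ (u - h)) ^ n - (/ u) ^ n - INR n * h * (/ u) ^ S n) <= K * (Cmod h * Cmod h))%R.
Proof.
intros HN. induction n as [|n [K [K0 HK]]].
- exists 0%R. split; [lra|]. intros u h _ _ _ _.
  simpl. replace (1 - 1 - 0 * h * (/ u * 1)) with (RtoC 0) by ring. rewrite Cmod_0. lra.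
- exists (N * K + INR (S n) * N ^ S (S (S n)))%R. split.
  { apply Rplus_le_le_0_compat; apply Rmult_le_pos; auto; [apply pos_INR|apply pow_le; auto]. }
  intros u h Hu Huh Ha Hb. specialize (HK u h Hu Huh Ha Hb).
  assert (E : / (u - h) = / u + h * / u * / (u - h)) by (field; auto).
  set (a := / u) in *. set (b := / (u - h)) in *.
  replace (b ^ S n - a ^ S n - INR (S n) * h * a ^ S (S n)) with
    (b * (b ^ n - a ^ n - INR n * h * a ^ S n) + INR (S n) * ((h * h) * (a ^ S (S n) * b))).
  2:{ rewrite !Cpow_S. rewrite S_INR, RtoC_plus.
      set (A := a ^ n). set (B := b ^ n).
      transitivity (b * B - b * A - INR n * h * (a * A) * b + (INR n + 1) * (h * (a * A) * (h * a * b))); [ring|].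
      replace (h * a * b) with (b - a) by (rewrite E at 1; ring).
      transitivity (b * B - A * (b - h * a * b) - (INR n + 1) * h * (a * (a * A))); [ring|].
      replace (b - h * a * b) with a by (rewrite E at 1; ring). ring. }
  eapply Rle_trans; [apply Cmod_triangle|]. rewrite Rmult_plus_distr_r.
  apply Rplus_le_compat.
  + rewrite Cmod_mult, Rmult_assoc. apply Rmult_le_compat; auto; apply Cmod_ge_0.
  + rewrite !Cmod_mult, Cmod_pow, Cmod_R, Rabs_right by (apply Rle_ge, pos_INR).
    rewrite (Rmult_assoc (INR (S n))). apply Rmult_le_compat_l; [apply pos_INR|].
    rewrite (Rmult_comm (N ^ _)). apply Rmult_le_compat_l.
    { apply Rmult_le_pos; apply Cmod_ge_0. }
    rewrite (Rmult_comm (_ ^ _)). change (N ^ S (S (S n)))%R with (N * N ^ S (S n))%R.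
    apply Rmult_le_compat; auto; [apply Cmod_ge_0|apply pow_le, Cmod_ge_0|].
    apply pow_incr. split; [apply Cmod_ge_0|exact Ha].
Qed.

Theorem Cauchy_int_derive (phi : R -> C) (c w : C) (rho : R) (n : nat) :
  (forall t, path_cont phi t) -> (Cmod (w - c) < rho)%R ->
  is_Cderive (Cauchy_int phi c rho n) w (INR n * Cauchy_int phi c rho (S n) w).
Proof.
intros Hphi Hw. assert (P := Cmod_ge_0 (w - c)). assert (HPI := PI_RGT_0).
set (m := (rho - Cmod (w - c))%R). assert (m0 : (0 < m)%R) by (unfold m; lra).
destruct (path_cont_bounded phi 0 (2 * PI) ltac:(lra) Hphi) as [M HM].
assert (M0 : (0 <= M)%R) by (eapply Rle_trans; [apply Cmod_ge_0|apply (HM 0%R); lra]).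
(* [m] is the distance from [w] to the circle; points within m / 2 of [w] stay at distance at least
   m / 2 from it, so the inverses are bounded by 2 / m. *)
destruct (inv_pow_taylor (2 / m) n) as [K [K0 HK]].
{ apply Rlt_le, Rdiv_lt_0_compat; lra. }
apply is_Cderive_eps. intros eps He.
set (A := (M * K * (2 * PI) + 1)%R).
assert (A0 : (0 < A)%R).
{ unfold A. assert (0 <= M * K * (2 * PI))%R by (apply Rmult_le_pos; [apply Rmult_le_pos|]; lra). lra. }
exists (Rmin (m / 2) (eps / A)). split; [apply Rmin_case; [lra|apply Rdiv_lt_0_compat; lra]|].
intros y Hy.
assert (Y1 := Rlt_le_trans _ _ _ Hy (Rmin_l _ _)).
assert (Y2 := Rlt_le_trans _ _ _ Hy (Rmin_r _ _)).
assert (Hyc : (Cmod (y - c) < rho - m / 2)%R).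
{ replace (y - c) with ((y - w) + (w - c)) by ring.
  eapply Rle_lt_trans; [apply Cmod_triangle|]. unfold m in *; lra. }
assert (Ex : forall k z, (Cmod (z - c) < rho)%R ->
  ex_CRInt (fun t => phi t * / (circ c rho t - z) ^ k) 0 (2 * PI)).
{ intros k z Hz. apply ex_CRInt_cont. intros t _. apply path_cont_Cauchy; auto. }
unfold Cauchy_int.
set (h := y - w) in *.
replace (INR n * CRInt (fun t => phi t * / (circ c rho t - w) ^ S n) 0 (2 * PI) * h)
  with ((INR n * h) * CRInt (fun t => phi t * / (circ c rho t - w) ^ S n) 0 (2 * PI)) by ring.
rewrite <- CRInt_scal by (apply Ex; auto).
rewrite <- CRInt_minus by (apply Ex; lra).
rewrite <- CRInt_minus.
2:{ apply ex_CRInt_minus; apply Ex; lra. }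
2:{ apply ex_CRInt_scal, Ex; auto. }
eapply Rle_trans; [apply CRInt_bound with (M := (M * (K * (Cmod h * Cmod h)))%R)|].
- lra.
- apply ex_CRInt_minus; [apply ex_CRInt_minus; apply Ex; lra|apply ex_CRInt_scal, Ex; auto].
- intros t Ht.
  assert (N1 := circ_neq c w rho t Hw).
  assert (N2 := circ_neq c y rho t ltac:(lra)).
  assert (Eu : circ c rho t - y = (circ c rho t - w) - h) by (unfold h; ring).
  assert (D1 := circ_dist c w rho t ltac:(lra)).
  assert (D2 := circ_dist c y rho t ltac:(lra)).
  rewrite <- !Cpow_inv by auto.
  rewrite Eu in *. set (u := circ c rho t - w) in *.
  replace (phi t * (/ (u - h)) ^ n - phi t * (/ u) ^ n - INR n * h * (phi t * (/ u) ^ S n))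
    with (phi t * ((/ (u - h)) ^ n - (/ u) ^ n - INR n * h * (/ u) ^ S n)) by ring.
  rewrite Cmod_mult. apply Rmult_le_compat; try apply Cmod_ge_0; [auto|].
  apply HK; auto; rewrite Cmod_inv by auto; replace (2 / m)%R with (/ (m / 2))%R by (field; lra);
    apply Rinv_le_contravar; unfold m in *; lra.
- rewrite Rminus_0_r.
  assert (Z := Cmod_ge_0 h).
  assert (B : (A * Cmod h <= eps)%R).
  { apply (Rmult_lt_compat_l A) in Y2; auto.
    replace (A * (eps / A))%R with eps in Y2 by (field; lra). lra. }
  replace (M * (K * (Cmod h * Cmod h)) * (2 * PI))%R with ((A - 1) * Cmod h * Cmod h)%R
    by (unfold A; ring).
  apply Rmult_le_compat_r; auto. nra.
Qed.

Lemma analytic_is_Cderive (f : C -> C) (z : C) : analytic f -> unit_disc z ->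
  is_Cderive f z (C_derive f z).
Proof. intros H Hz. apply Cderive_correct, H, Hz. Qed.

Lemma in_unit_disc_ball (c z : C) : (Cmod (z - c) < 1 - Cmod c)%R -> unit_disc z.
Proof.
intros H. unfold unit_disc. replace z with ((z - c) + c) by ring.
eapply Rle_lt_trans; [apply Cmod_triangle|]. lra.
Qed.

Lemma Cauchy_int_1 (F f : C -> C) (c w : C) (rho R0 : R) :
  (Cmod (w - c) < rho)%R -> (rho < R0)%R ->
  (forall z, (Cmod (z - c) < R0)%R -> is_Cderive F z (f z)) ->
  (forall z, (Cmod (z - c) < R0)%R -> ex_Cderive f z) ->
  F w = / RtoC (2 * PI) * Cauchy_int (fun t => F (circ c rho t) * (rho * cis t)) c rho 1 w.
Proof.
intros H1 H2 HF Hf.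
assert (N : RtoC (2 * PI) <> 0) by (apply RtoC_neq_0; generalize PI_RGT_0; lra).
assert (T := Cauchy_formula F f c w rho R0 H1 H2 HF Hf).
transitivity (/ RtoC (2 * PI) * (RtoC (2 * PI) * F w)).
- rewrite Cmult_assoc, Cinv_l, Cmult_1_l; auto.
- rewrite <- T. f_equal. unfold Cauchy_int. apply CRInt_ext. intros t _.
  unfold ckern. rewrite Cpow_1_r. unfold Cdiv. ring.
Qed.

Lemma path_cont_on_circ (F f : C -> C) (c : C) (rho R0 t : R) : (0 <= rho < R0)%R ->
  (forall z, (Cmod (z - c) < R0)%R -> is_Cderive F z (f z)) ->
  path_cont (fun t => F (circ c rho t) * (rho * cis t)) t.
Proof.
intros H HF. apply path_cont_mult.
- apply path_cont_comp; [|apply path_cont_circ]. eexists. apply HF.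
  unfold circ. replace (c + rho * cis t - c) with (rho * cis t) by ring.
  rewrite Cmod_mult, Cmod_R, Cmod_cis, Rabs_right; lra.
- apply (path_cont_mult (fun _ => RtoC rho)); [apply path_cont_const|apply path_cont_cis].
Qed.

Lemma is_Cderive_scal (k : C) (f : C -> C) (z l : C) :
  is_Cderive f z l -> is_Cderive (fun x => k * f x) z (k * l).
Proof.
intros H. apply (is_Cderive_eq _ _ _ (0 * f z + k * l)); [|ring].
apply (is_Cderive_mult (fun _ => k) f); [apply is_Cderive_const|exact H].
Qed.

(* The Cauchy formula is applied to a primitive of [f], because the derivation of that formula
   needs a holomorphic derivative. *)
Theorem analytic_derive (f : C -> C) : analytic f -> analytic (C_derive f).
Proof.
intros Hf c Hc. unfold unit_disc in Hc.
destruct (analytic_primitive f Hf) as [F [_ HF]].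
set (R0 := (1 - Cmod c)%R). set (rho := (R0 / 2)%R).
assert (r0 : (0 < rho < R0)%R) by (unfold rho, R0; lra).
assert (HF' : forall z, (Cmod (z - c) < R0)%R -> is_Cderive F z (f z)).
{ intros z Hz. apply HF, (in_unit_disc_ball c), Hz. }
assert (Hf' : forall z, (Cmod (z - c) < R0)%R -> ex_Cderive f z).
{ intros z Hz. apply Hf, (in_unit_disc_ball c), Hz. }
set (phi := fun t => F (circ c rho t) * (rho * cis t)).
assert (Hphi : forall t, path_cont phi t) by (intros t; apply (path_cont_on_circ F f c rho R0); auto; lra).
set (k := / RtoC (2 * PI)).
assert (E0 : forall w, (Cmod (w - c) < rho)%R -> F w = k * Cauchy_int phi c rho 1 w).
{ intros w Hw. apply (Cauchy_int_1 F f c w rho R0); auto; lra. }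
assert (room : forall w, (Cmod (w - c) < rho)%R -> forall y,
  (Cmod (y - w) < rho - Cmod (w - c))%R -> (Cmod (y - c) < rho)%R).
{ intros w Hw y Hy. replace (y - c) with ((y - w) + (w - c)) by ring.
  eapply Rle_lt_trans; [apply Cmod_triangle|]. lra. }
assert (E1 : forall w, (Cmod (w - c) < rho)%R -> f w = k * (INR 1 * Cauchy_int phi c rho 2 w)).
{ intros w Hw.
  rewrite <- (is_Cderive_unique F w (f w)) by (apply HF'; lra).
  apply is_Cderive_unique.
  apply (is_Cderive_ext_ball (fun w => k * Cauchy_int phi c rho 1 w) F w _ (rho - Cmod (w - c))); [lra| |].
  - intros y Hy. symmetry; apply E0. eapply room; eassumption.
  - apply is_Cderive_scal, Cauchy_int_derive; auto. }
(* The formula is established on a whole ball and not just at [c], because it is differentiated once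
   more. The exponents 1, 2, 3, 4 belong to F, f, f' and f''. *)
assert (E2 : forall w, (Cmod (w - c) < rho)%R ->
  C_derive f w = k * (INR 1 * (INR 2 * Cauchy_int phi c rho 3 w))).
{ intros w Hw. apply is_Cderive_unique.
  apply (is_Cderive_ext_ball (fun w => k * (INR 1 * Cauchy_int phi c rho 2 w)) f w _ (rho - Cmod (w - c))); [lra| |].
  - intros y Hy. symmetry; apply E1. eapply room; eassumption.
  - apply is_Cderive_scal, is_Cderive_scal, Cauchy_int_derive; auto. }
assert (Z : (Cmod (c - c) < rho)%R).
{ replace (c - c) with (RtoC 0) by ring. rewrite Cmod_0. lra. }
exists (k * (INR 1 * (INR 2 * (INR 3 * Cauchy_int phi c rho 4 c)))).
apply (is_Cderive_ext_ball (fun w => k * (INR 1 * (INR 2 * Cauchy_int phi c rho 3 w))) _ c _ rho); [lra| |].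
- intros y Hy. symmetry; apply E2, Hy.
- do 3 apply is_Cderive_scal. apply Cauchy_int_derive; auto.
Qed.

(* With [f 0 = 0], subtracting the Cauchy formulas at [w] and [0] exhibits [f w / w] near [0]
   as a Cauchy integral. *)
Theorem analytic_factor_id (f : C -> C) : analytic f -> f 0 = 0 ->
  exists k : C -> C, analytic k /\ k 0 = C_derive f 0 /\ forall z, unit_disc z -> f z = z * k z.
Proof.
intros Hf f0.
assert (D0 : unit_disc 0) by (unfold unit_disc; rewrite Cmod_0; lra).
exists (fun z => if Ceq_dec z 0 then C_derive f 0 else f z / z).
split; [|split].
2:{ destruct (Ceq_dec 0 0) as [_|E]; [reflexivity|elim E; reflexivity]. }
2:{ intros z _. destruct (Ceq_dec z 0) as [->|E]; [rewrite f0; ring|field; exact E]. }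
assert (Hd := analytic_derive f Hf).
set (phi := fun t => f (circ 0 (1/2) t) * (RtoC (1/2) * cis t)).
assert (S0 : forall z, z - 0 = z) by (intros; ring).
assert (HF' : forall z, (Cmod (z - 0) < 1)%R -> is_Cderive f z (C_derive f z)).
{ intros z Hz. rewrite S0 in Hz. apply analytic_is_Cderive; auto. }
assert (Hphi : forall t, path_cont phi t)
  by (intros t; apply (path_cont_on_circ f (C_derive f) 0 (1/2) 1); auto; lra).
set (k := / RtoC (2 * PI)).
assert (E0 : forall w, (Cmod w < 1/2)%R -> f w = k * Cauchy_int phi 0 (1/2) 1 w).
{ intros w Hw. apply (Cauchy_int_1 f (C_derive f) 0 w (1/2) 1); auto; try lra.
  - rewrite S0; lra.
  - intros z Hz. apply Hd. rewrite S0 in Hz. exact Hz. }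
(* The extra division by zeta comes from 1 / (zeta - w) - 1 / zeta = w / (zeta (zeta - w)). *)
set (psi := fun t => phi t * / circ 0 (1/2) t ^ 1).
assert (Cn : forall w t, (Cmod w < 1/2)%R -> circ 0 (1/2) t - w <> 0).
{ intros w t Hw. apply circ_neq. rewrite S0. exact Hw. }
assert (Cn0 : forall t, circ 0 (1/2) t <> 0).
{ intros t. rewrite <- (S0 (circ _ _ _)). apply Cn. rewrite Cmod_0. lra. }
assert (Hpsi : forall t, path_cont psi t).
{ intros t. unfold psi. apply (path_cont_ext (fun t => phi t * / (circ 0 (1/2) t - 0) ^ 1)).
  - intros s. rewrite S0. reflexivity.
  - apply path_cont_Cauchy; auto. rewrite S0, Cmod_0. lra. }
assert (E1 : forall w, (Cmod w < 1/2)%R -> f w = w * (k * Cauchy_int psi 0 (1/2) 1 w)).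
{ intros w Hw. replace (f w) with (f w - f 0) by (rewrite f0; ring).
  rewrite (E0 w Hw), (E0 0) by (rewrite Cmod_0; lra).
  assert (X : forall v, (Cmod v < 1/2)%R -> ex_CRInt (fun t => phi t * / (circ 0 (1/2) t - v) ^ 1) 0 (2 * PI)).
  { intros v Hv. apply ex_CRInt_cont. intros t _. apply path_cont_Cauchy; auto. rewrite S0; lra. }
  replace (k * Cauchy_int phi 0 (1/2) 1 w - k * Cauchy_int phi 0 (1/2) 1 0) with
    (k * (Cauchy_int phi 0 (1/2) 1 w - Cauchy_int phi 0 (1/2) 1 0)) by ring.
  rewrite (Cmult_comm w), <- Cmult_assoc. f_equal. rewrite Cmult_comm.
  unfold Cauchy_int.
  rewrite <- CRInt_scal.
  2:{ apply ex_CRInt_cont. intros t _. apply path_cont_Cauchy; auto. rewrite S0; lra. }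
  rewrite <- CRInt_minus by (apply X; rewrite ?Cmod_0; lra).
  apply CRInt_ext. intros t _. unfold psi. rewrite !Cpow_1_r, S0.
  field. split; auto. }
assert (D : forall w, (Cmod w < 1/2)%R ->
   is_Cderive (fun w => k * Cauchy_int psi 0 (1/2) 1 w) w (k * (INR 1 * Cauchy_int psi 0 (1/2) 2 w))).
{ intros w Hw. apply is_Cderive_scal, Cauchy_int_derive; auto. rewrite S0; lra. }
assert (H0 : (Cmod 0 < 1/2)%R) by (rewrite Cmod_0; lra).
(* The Cauchy integral takes the prescribed value at 0, so it agrees with the piecewise quotient on
   the whole small ball, centre included. *)
assert (V0 : C_derive f 0 = k * Cauchy_int psi 0 (1/2) 1 0).
{ apply is_Cderive_unique.
  apply (is_Cderive_ext_ball (fun w => w * (k * Cauchy_int psi 0 (1/2) 1 w)) f 0 _ (1/2)); [lra| |].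
  - intros y Hy. rewrite S0 in Hy. symmetry; apply E1, Hy.
  - eapply is_Cderive_eq; [apply (is_Cderive_mult (fun w => w)); [apply is_Cderive_id|apply D, H0]|].
    cbv beta; ring. }
intros z Hz. destruct (Ceq_dec z 0) as [->|Hz0].
- eexists. apply (is_Cderive_ext_ball (fun w => k * Cauchy_int psi 0 (1/2) 1 w) _ 0 _ (1/2)); [lra| |apply D, H0].
  intros y Hy. rewrite S0 in Hy. simpl.
  destruct (Ceq_dec y 0) as [->|Hy0]; [symmetry; exact V0|].
  rewrite (E1 y Hy). field. exact Hy0.
- eexists. assert (P := proj1 (Cmod_gt_0 z) Hz0).
  apply (is_Cderive_ext_ball (fun w => f w / w) _ z _ (Cmod z)); [exact P| |].
  + intros y Hy. destruct (Ceq_dec y 0) as [->|Hy0]; [|reflexivity].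
    exfalso. replace (0 - z) with (- z) in Hy by ring. rewrite Cmod_opp in Hy. lra.
  + apply (is_Cderive_div f (fun w => w)); [apply analytic_is_Cderive; auto|apply is_Cderive_id|exact Hz0].
Qed.

(** * Poisson kernel and Harnack's inequality *)

Definition poisson (t s : R) : R := ((1 - t * t) / (1 - 2 * t * cos s + t * t))%R.

(** The denominator is the squared distance from [cis s] to the real point [t], at least (1 -
    t)^2. *)
Lemma poisson_den (t s : R) : (0 <= t < 1)%R -> (0 < 1 - 2 * t * cos s + t * t)%R.
Proof. intros H. generalize (COS_bound s). nra. Qed.

(** The denominator is at most (1 + t)^2, and (1 - t^2) / (1 + t)^2 = (1 - t) / (1 + t). *)
Lemma poisson_lower (t s : R) : (0 <= t < 1)%R -> ((1 - t) / (1 + t) <= poisson t s)%R.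
Proof.
intros H. unfold poisson. assert (P := poisson_den t s H).
apply (Rmult_le_reg_r (1 - 2 * t * cos s + t * t)); [exact P|].
unfold Rdiv. rewrite (Rmult_assoc (1 - t * t)), Rinv_l, Rmult_1_r by lra.
apply (Rmult_le_reg_r (1 + t)); [lra|].
replace ((1 - t) * / (1 + t) * (1 - 2 * t * cos s + t * t) * (1 + t))%R with
  ((1 - t) * (1 - 2 * t * cos s + t * t))%R by (field; lra).
assert (B := COS_bound s).
assert (1 - 2 * t * cos s + t * t <= (1 + t) * (1 + t))%R by nra. nra.
Qed.

(* The Poisson kernel is the Cauchy kernel plus [t z / (1 - t z)], which is holomorphic in the
   closed disc and vanishes at [0], so its contribution has mean zero. *)
Lemma poisson_formula (G g : C -> C) (R0 t : R) : (0 <= t < 1)%R -> (1 < R0)%R ->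
  (forall z, (Cmod z < R0)%R -> is_Cderive G z (g z)) ->
  (forall z, (Cmod z < R0)%R -> ex_Cderive g z) ->
  @is_RInt C_R_NormedModule (fun s => G (cis s) * RtoC (poisson t s)) 0 (2 * PI) (RtoC (2 * PI) * G t).
Proof.
intros Ht HR HG Hg.
(* The second bound keeps t |z| below 1, hence 1 - t z away from 0, on a disc still larger than the
   unit disc. *)
set (R1 := Rmin R0 (2 / (1 + t))).
assert (HR1 : (1 < R1)%R) by (apply Rmin_case; [lra|apply Rlt_div_r; lra]).
assert (N : forall z, (Cmod z < R1)%R -> 1 - t * z <> 0).
{ intros z Hz. apply one_minus_neq_0. rewrite Cmod_mult, Cmod_R, Rabs_right by lra.
  assert (Hz2 := Rlt_le_trans _ _ _ Hz (Rmin_r _ _)).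
  assert (E : (2 / (1 + t) * (1 + t) = 2)%R) by (field; lra).
  generalize (Cmod_ge_0 z). nra. }
assert (Hz0 : forall z, z - 0 = z) by (intros; ring).
assert (Ct : (Cmod (t - 0) < 1)%R) by (rewrite Hz0, Cmod_R, Rabs_right; lra).
assert (A := Cauchy_formula G g 0 t 1 R0 Ct HR).
set (q := fun z => t * z * / (1 - t * z)).
assert (Dq : forall z, (Cmod z < R1)%R -> is_Cderive q z (t * / (1 - t * z) * / (1 - t * z))).
{ intros z Hz. eapply is_Cderive_eq.
  - apply (is_Cderive_mult (fun z => t * z) (fun z => / (1 - t * z))).
    + apply is_Cderive_scal, is_Cderive_id.
    + apply Cinv_linear_derive, N, Hz.
  - field. apply N, Hz. }
assert (Lt : forall z, (Cmod z < R1)%R -> (Cmod z < R0)%R).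
{ intros z Hz. eapply Rlt_le_trans; [exact Hz|apply Rmin_l]. }
assert (B := circle_mean (fun z => G z * q z)
  (fun z => g z * q z + G z * (t * / (1 - t * z) * / (1 - t * z))) R1 HR1).
assert (ExA : ex_CRInt (fun s => G (circ 0 1 s) * ckern 0 t 1 s) 0 (2 * PI)).
{ apply ex_CRInt_cont; intros s _. apply path_cont_mult; [|apply path_cont_ckern; auto].
  apply path_cont_comp; [|apply path_cont_circ]. eexists; apply HG.
  unfold circ. replace (0 + 1 * cis s) with (cis s) by ring. rewrite Cmod_cis; lra. }
assert (ExB : ex_CRInt (fun s => G (cis s) * q (cis s)) 0 (2 * PI)).
{ apply ex_CRInt_cont; intros s _. apply path_cont_mult; apply path_cont_comp; try apply path_cont_cis.
  - eexists; apply HG. rewrite Cmod_cis; lra.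
  - eexists; apply Dq. rewrite Cmod_cis; lra. }
assert (T := @is_RInt_plus C_R_NormedModule _ _ _ _ _ _ (CRInt_correct _ _ _ ExA) (CRInt_correct _ _ _ ExB)).
rewrite A, B in T.
- replace (RtoC (2 * PI) * G t) with (RtoC (2 * PI) * G t + RtoC (2 * PI) * (G 0 * q 0)).
  2:{ unfold q. ring. }
  eapply (@is_RInt_ext C_R_NormedModule); [|exact T].
  intros s _. match goal with |- ?x = ?y => change (@eq C x y) end.
  change (G (circ 0 1 s) * ckern 0 t 1 s + G (cis s) * q (cis s) = G (cis s) * poisson t s).
  unfold ckern, q.
  assert (N1 := circ_neq 0 t 1 s Ct).
  assert (Ec : circ 0 1 s = cis s) by (unfold circ; ring).
  rewrite Ec in *.
  assert (N2 := N (cis s) ltac:(rewrite Cmod_cis; lra)).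
  assert (P := poisson_den t s Ht).
  rewrite <- Cmult_plus_distr_l. f_equal.
  unfold poisson. rewrite RtoC_div by lra.
  assert (N3 : RtoC (1 - 2 * t * cos s + t * t) <> 0) by (apply RtoC_neq_0; lra).
  assert (M : (cis s - t) * (1 - t * cis s) = cis s * RtoC (1 - 2 * t * cos s + t * t)).
  { generalize (sin2_cos2 s). unfold Rsqr. intros sc.
    unfold cis, RtoC, Cminus, Cplus, Copp, Cmult; simpl.
    f_equal; [|ring].
    transitivity (cos s + t * (sin s * sin s - cos s * cos s) + t * t * cos s - t)%R; [ring|].
    replace (sin s * sin s)%R with (1 - cos s * cos s)%R by lra. ring. }
  assert (N4 : cis s <> 0).
  { intros E. assert (Q := Cmod_cis s). rewrite E, Cmod_0 in Q. lra. }
  replace (1 * cis s / (cis s - t) + t * cis s * / (1 - t * cis s)) with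
    (cis s * RtoC (1 - t * t) / ((cis s - t) * (1 - t * cis s))).
  + rewrite M. field. split; auto.
  + rewrite RtoC_minus, RtoC_mult. field. split; auto.
- intros z Hz. apply is_Cderive_mult; [apply HG, Lt, Hz|apply Dq, Hz].
- intros z Hz. destruct (Hg z (Lt z Hz)) as [l Hl]. eexists.
  apply (is_Cderive_plus (fun z => g z * q z) (fun z => G z * (t * / (1 - t * z) * / (1 - t * z)))).
  + apply is_Cderive_mult; [exact Hl|apply Dq, Hz].
  + apply is_Cderive_mult; [apply HG, Lt, Hz|].
    apply (is_Cderive_mult (fun z => t * / (1 - t * z)) (fun z => / (1 - t * z))).
    * apply is_Cderive_scal, Cinv_linear_derive, N, Hz.
    * apply Cinv_linear_derive, N, Hz.
- intros z Hz. rewrite Hz0 in Hz. auto.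
- intros z Hz. rewrite Hz0 in Hz. auto.
Qed.

(** Since Re G >= 0, the lower bound of the Poisson kernel may be multiplied by Re G and integrated;
    the mean value property evaluates the smaller side. *)
Theorem Harnack (G g : C -> C) (R0 t : R) : (0 <= t < 1)%R -> (1 < R0)%R ->
  (forall z, (Cmod z < R0)%R -> is_Cderive G z (g z)) ->
  (forall z, (Cmod z < R0)%R -> ex_Cderive g z) ->
  (forall z, (Cmod z < R0)%R -> (0 <= Re (G z))%R) ->
  ((1 - t) / (1 + t) * Re (G 0) <= Re (G t))%R.
Proof.
intros Ht HR HG Hg Hpos. assert (HPI := PI_RGT_0).
assert (A := poisson_formula G g R0 t Ht HR HG Hg).
assert (B := circle_mean G g R0 HR HG Hg).
assert (ExB : ex_CRInt (fun s => G (cis s)) 0 (2 * PI)).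
{ apply ex_CRInt_cont; intros s _. apply path_cont_comp; [|apply path_cont_cis].
  eexists; apply HG. rewrite Cmod_cis; lra. }
assert (B' := CRInt_re _ _ _ ExB). rewrite B, re_scal_l in B'.
assert (A' := is_RInt_fct_extend_fst (U := R_NormedModule) (V := R_NormedModule) _ _ _ _ A).
change (is_RInt (fun s => Re (G (cis s) * RtoC (poisson t s))) 0 (2 * PI) (Re (RtoC (2 * PI) * G t))) in A'.
rewrite re_scal_l in A'.
apply (is_RInt_scal _ _ _ ((1 - t) / (1 + t))%R) in B'.
assert (T := is_RInt_le _ _ 0 (2 * PI) _ _ ltac:(lra) B' A').
apply (Rmult_le_reg_l (2 * PI)); [lra|].
refine (Rle_trans _ _ _ _ (T _)).
- right. change ((2 * PI) * ((1 - t) / (1 + t) * Re (G 0)) = (1 - t) / (1 + t) * (2 * PI * Re (G 0)))%R. ring.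
- intros s _. rewrite re_scal_r.
  change ((1 - t) / (1 + t) * Re (G (cis s)) <= Re (G (cis s)) * poisson t s)%R.
  rewrite Rmult_comm. apply Rmult_le_compat_l.
  + apply Hpos. rewrite Cmod_cis; lra.
  + apply poisson_lower, Ht.
Qed.

(** * The exponential and subordination *)

Lemma Cexp_0 : Cexp 0 = 1.
Proof. unfold Cexp, RtoC; simpl. rewrite exp_0, cos_0, sin_0. f_equal; ring. Qed.

Lemma Cexp_plus (z w : C) : Cexp (z + w) = Cexp z * Cexp w.
Proof.
destruct z, w. unfold Cexp, Cmult; simpl. rewrite exp_plus, cos_plus, sin_plus. f_equal; ring.
Qed.

Lemma Cmod_Cexp (z : C) : Cmod (Cexp z) = exp (Re z).
Proof.
replace (Cexp z) with (RtoC (exp (Re z)) * cis (Im z)).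
- rewrite Cmod_mult, Cmod_R, Cmod_cis, Rabs_right, Rmult_1_r; [reflexivity|].
  apply Rle_ge, Rlt_le, exp_pos.
- unfold Cexp, cis, RtoC, Cmult; simpl. f_equal; ring.
Qed.

Lemma path_derive_Cexp_ray (z : C) (s : R) :
  path_derive (fun s => Cexp (RtoC s * z)) s (z * Cexp (RtoC s * z)).
Proof.
destruct z as [x y].
assert (E : forall s, (exp (s * x) * cos (s * y), exp (s * x) * sin (s * y))%R
   = Cexp (RtoC s * (x, y))) by (intros; unfold Cexp; rewrite re_scal_l, im_scal_l; reflexivity).
unfold path_derive. eapply (@is_derive_ext R_AbsRing C_R_NormedModule); [exact E|].
replace ((x, y) * Cexp (RtoC s * (x, y))) with
 ((x * exp (s * x) * cos (s * y) - exp (s * x) * (y * sin (s * y)),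
  x * exp (s * x) * sin (s * y) + exp (s * x) * (y * cos (s * y)))%R : C).
2:{ rewrite <- E. unfold Cmult; simpl. f_equal; ring. }
apply path_derive_pair; auto_derive; auto; ring.
Qed.

(** The left side is the modulus of the integral of h (e^(s h) - 1) over [0, 1]. A first integration
    along the ray bounds e^(s h) - 1 by |h| e^|h|, and a second one supplies the other factor
    |h|. *)
Lemma Cexp_first_order (h : C) : (Cmod (Cexp h - 1 - h) <= exp (Cmod h) * (Cmod h * Cmod h))%R.
Proof.
assert (P := Cmod_ge_0 h).
assert (ray : forall s, CRInt (fun s => h * Cexp (RtoC s * h)) 0 s = Cexp (RtoC s * h) - 1).
{ intros s. rewrite (CRInt_derive (fun s => Cexp (RtoC s * h))).
  - rewrite Cmult_0_l, Cexp_0. reflexivity.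
  - intros t _. apply path_derive_Cexp_ray.
  - intros t _. apply (path_cont_mult (fun _ => h)); [apply path_cont_const|].
    eapply path_derive_cont, path_derive_Cexp_ray. }
assert (C1 : forall t, path_cont (fun s => h * Cexp (RtoC s * h)) t).
{ intros t. apply (path_cont_mult (fun _ => h)); [apply path_cont_const|].
  eapply path_derive_cont, path_derive_Cexp_ray. }
assert (B : forall s, (0 <= s <= 1)%R -> (Cmod (Cexp (RtoC s * h)) <= exp (Cmod h))%R).
{ intros s Hs. rewrite Cmod_Cexp. 
  assert (re_le : (Re (RtoC s * h) <= Cmod h)%R).
  { rewrite re_scal_l. assert (T := re_le_Cmod h). assert (T2 := Rle_abs (Re h)).
    destruct (Rle_dec 0 (Re h)); nra. }
  destruct re_le as [L|L]; [left; apply exp_increasing, L|right; rewrite L; reflexivity]. }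
assert (B1 : forall s, (0 <= s <= 1)%R -> (Cmod (Cexp (RtoC s * h) - 1) <= Cmod h * exp (Cmod h))%R).
{ intros s Hs. rewrite <- ray.
  eapply Rle_trans; [apply CRInt_bound with (M := (Cmod h * exp (Cmod h))%R)|].
  - lra.
  - apply ex_CRInt_cont; auto.
  - intros t Ht. rewrite Cmod_mult. apply Rmult_le_compat_l; auto. apply B; lra.
  - rewrite Rminus_0_r. assert (0 <= Cmod h * exp (Cmod h))%R
      by (apply Rmult_le_pos; auto; apply Rlt_le, exp_pos). nra. }
assert (E : CRInt (fun s => h * Cexp (RtoC s * h) - h) 0 1 = Cexp h - 1 - h).
{ rewrite CRInt_minus.
  - rewrite ray, CRInt_const, Cmult_1_l. rewrite Rminus_0_r, Cmult_1_l. reflexivity.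
  - apply ex_CRInt_cont; auto.
  - apply (@ex_RInt_const C_R_NormedModule). }
rewrite <- E.
eapply Rle_trans; [apply CRInt_bound with (M := (exp (Cmod h) * (Cmod h * Cmod h))%R)|].
- lra.
- apply ex_CRInt_minus; [apply ex_CRInt_cont; auto|apply (@ex_RInt_const C_R_NormedModule)].
- intros t Ht. replace (h * Cexp (t * h) - h) with (h * (Cexp (t * h) - 1)) by ring.
  rewrite Cmod_mult. specialize (B1 t Ht). nra.
- right; ring.
Qed.

Lemma is_Cderive_Cexp (z : C) : is_Cderive Cexp z (Cexp z).
Proof.
apply is_Cderive_eps. intros eps He.
set (A := (exp (Re z) * exp 1)%R).
assert (A0 : (0 < A)%R) by (apply Rmult_lt_0_compat; apply exp_pos).
exists (Rmin 1 (eps / A)). split; [apply Rmin_case; [lra|apply Rdiv_lt_0_compat; lra]|].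
intros y Hy. set (h := y - z) in *.
assert (Y1 := Rlt_le_trans _ _ _ Hy (Rmin_l _ _)).
assert (Y2 := Rlt_le_trans _ _ _ Hy (Rmin_r _ _)).
replace y with (z + h) by (unfold h; ring). rewrite Cexp_plus.
replace (Cexp z * Cexp h - Cexp z - Cexp z * h) with (Cexp z * (Cexp h - 1 - h)) by ring.
rewrite Cmod_mult, Cmod_Cexp.
assert (T := Cexp_first_order h). assert (P := Cmod_ge_0 h).
assert (E1 : (exp (Cmod h) <= exp 1)%R) by (left; apply exp_increasing; lra).
assert (B : (A * Cmod h <= eps)%R).
{ apply (Rmult_lt_compat_l A) in Y2; auto.
  replace (A * (eps / A))%R with eps in Y2 by (field; lra). lra. }
apply Rle_trans with (exp (Re z) * (exp 1 * (Cmod h * Cmod h)))%R.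
- apply Rmult_le_compat_l; [apply Rlt_le, exp_pos|].
  eapply Rle_trans; [exact T|]. apply Rmult_le_compat_r; nra.
- replace (exp (Re z) * (exp 1 * (Cmod h * Cmod h)))%R with (A * Cmod h * Cmod h)%R by (unfold A; ring).
  apply Rmult_le_compat_r; auto.
Qed.

Lemma Clog_Cexp (z : C) : (Rabs (Im z) < PI)%R -> Clog (Cexp z) = z.
Proof.
intros H. apply Rabs_def2 in H. destruct z as [x y]; simpl in H.
assert (E := exp_pos x).
unfold Clog. f_equal.
- rewrite Cmod_Cexp. apply ln_exp.
- unfold Carg. rewrite Cmod_Cexp. unfold Cexp; simpl.
  replace (exp x * cos y / exp x)%R with (cos y) by (field; lra).
  (* As |y| < PI, the sign of [sin y] decides which of y and -y lies in [0, PI], the range of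
     [acos]. *)
  destruct Rle_dec as [G|G].
  + apply acos_cos. split; [|lra]. apply Rnot_lt_le. intros N.
    assert (S := sin_gt_0 (- y) ltac:(lra) ltac:(lra)). rewrite sin_neg in S. nra.
  + rewrite <- cos_neg, acos_cos; [ring|]. split; [|lra].
    apply Rnot_lt_le. intros N. apply G.
    assert (S := sin_ge_0 y ltac:(lra) ltac:(lra)). nra.
Qed.

(** * Rays, logarithms and the bound on the imaginary part *)

Lemma unit_disc_ray (z : C) (t : R) : unit_disc z -> (0 <= t <= 1)%R -> unit_disc (RtoC t * z)%C.
Proof.
unfold unit_disc. intros H Ht. rewrite Cmod_mult, Cmod_R, Rabs_right by lra.
generalize (Cmod_ge_0 z). nra.
Qed.

Lemma path_derive_ray (z : C) (t : R) : path_derive (fun t => RtoC t * z) t z.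
Proof.
unfold path_derive.
apply (@is_derive_ext R_AbsRing C_R_NormedModule (fun t => 0 + z * RtoC t)).
- intros s. match goal with |- ?x = ?y => change (@eq C x y) end. ring.
- replace z with (z * 1) at 2 by ring.
  assert (T := path_derive_affine 0 z RtoC t 1 (path_derive_RtoC t)).
  rewrite Cmult_1_r in T. rewrite ?Cmult_1_r. exact T.
Qed.

Lemma path_derive_along_ray (f : C -> C) (z l : C) (t : R) : is_Cderive f (RtoC t * z)%C l ->
  path_derive (fun t => f (RtoC t * z)%C) t (l * z).
Proof. intros H. apply (path_derive_comp f (fun t => RtoC t * z)); [exact H|apply path_derive_ray]. Qed.

Lemma zero_derive_const (E : C -> C) : (forall z, unit_disc z -> is_Cderive E z 0) ->
  forall z, unit_disc z -> E z = E 0.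
Proof.
intros H z Hz. apply Ceq_minus.
assert (T : CRInt (fun _ => 0) 0 1 = E (RtoC 1 * z) - E (RtoC 0 * z)).
{ apply (CRInt_derive (fun t => E (RtoC t * z)%C)).
  - rewrite Rmin_left, Rmax_right by lra. intros t Ht.
    replace (RtoC 0) with (RtoC 0 * z) by ring.
    apply path_derive_along_ray, H, unit_disc_ray; auto.
  - intros t _. apply path_cont_const. }
rewrite Cmult_1_l, Cmult_0_l in T. rewrite <- T, CRInt_const. ring.
Qed.

Lemma unit_disc_0 : unit_disc 0.
Proof. unfold unit_disc. rewrite Cmod_0. lra. Qed.

Lemma analytic_mult (f g : C -> C) : analytic f -> analytic g -> analytic (fun z => f z * g z).
Proof.
intros Hf Hg z Hz. eexists. apply is_Cderive_mult; apply analytic_is_Cderive; eassumption.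
Qed.

Lemma analytic_plus (f g : C -> C) : analytic f -> analytic g -> analytic (fun z => f z + g z).
Proof.
intros Hf Hg z Hz. eexists. apply is_Cderive_plus; apply analytic_is_Cderive; eassumption.
Qed.

Lemma analytic_div (f g : C -> C) : analytic f -> analytic g ->
  (forall z, unit_disc z -> g z <> 0) -> analytic (fun z => f z / g z).
Proof.
intros Hf Hg Hg0 z Hz. eexists. apply is_Cderive_div.
- apply analytic_is_Cderive; eassumption.
- apply analytic_is_Cderive; eassumption.
- auto.
Qed.

Lemma analytic_id : analytic (fun z => z).
Proof. intros z _. eexists. apply is_Cderive_id. Qed.

(** [L] is a primitive of p'/p; then p e^(-L) has derivative 0 and therefore keeps its value 1 at
    the origin. *)
Theorem analytic_log (p : C -> C) : analytic p -> (forall z, unit_disc z -> p z <> 0) -> p 0 = 1 ->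
  exists L : C -> C, L 0 = 0 /\ (forall z, unit_disc z -> is_Cderive L z (C_derive p z / p z)) /\
    (forall z, unit_disc z -> p z = Cexp (L z)).
Proof.
intros Hp Hp0 p0.
destruct (analytic_primitive (fun z => C_derive p z / p z)) as [L [L0 HL]].
{ apply analytic_div; auto. apply analytic_derive, Hp. }
exists L. split; [exact L0|]. split; [exact HL|].
intros z Hz.
assert (T := zero_derive_const (fun z => p z * Cexp ((-1) * L z))).
rewrite <- (Cmult_1_l (Cexp (L z))).
replace (RtoC 1) with (p z * Cexp ((-1) * L z)).
- rewrite <- Cmult_assoc, <- Cexp_plus. replace ((-1) * L z + L z) with (RtoC 0) by ring.
  rewrite Cexp_0. ring.
- rewrite T; auto.
  + rewrite p0, L0. replace ((-1) * 0) with (RtoC 0) by ring. rewrite Cexp_0. ring.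
  + intros w Hw. eapply is_Cderive_eq.
    * apply (is_Cderive_mult p (fun z => Cexp ((-1) * L z))).
      -- apply analytic_is_Cderive; auto.
      -- apply (is_Cderive_comp Cexp (fun z => (-1) * L z)); [apply is_Cderive_Cexp|].
         apply is_Cderive_scal, HL, Hw.
    * cbv beta. field. auto.
Qed.

(* Harnack's inequality for the nonnegative functions [Re (alpha +- i F)]. *)
Lemma Im_bound_ray (F : C -> C) (alpha : R) : analytic F -> F 0 = 0 ->
  (forall z, unit_disc z -> (Rabs (Im (F z)) < alpha)%R) ->
  forall z t, unit_disc z -> (0 <= t < 1)%R ->
    (Rabs (Im (F (RtoC t * z)%C)) <= 2 * alpha * t / (1 + t))%R.
Proof.
intros HF F0 Hb z t Hz Ht.
unfold unit_disc in Hz. assert (P := Cmod_ge_0 z).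
(* Chosen so that R0 > 1 and |z| R0 < 1: the function w -> F (z w) is then analytic beyond the unit
   circle, and its value at the real point t is F (t z). *)
set (R0 := (2 / (1 + Cmod z))%R).
assert (HR : (1 < R0)%R) by (apply Rlt_div_r; lra).
assert (Hin : forall w, (Cmod w < R0)%R -> unit_disc (z * w)).
{ intros w Hw. unfold unit_disc. rewrite Cmod_mult.
  assert (E : (R0 * (1 + Cmod z) = 2)%R) by (unfold R0; field; lra).
  generalize (Cmod_ge_0 w). nra. }
(* [kappa] stands for i or -i, and the real part of alpha + kappa F is then alpha - Im kappa Im F;
   the two signs give the two sides of the absolute value. *)
assert (K : forall kappa : C, Re kappa = 0%R -> (Rabs (Im kappa) = 1)%R ->
  ((1 - t) / (1 + t) * alpha <= alpha - Im kappa * Im (F (RtoC t * z)%C))%R).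
{ intros kappa K1 K2.
  assert (T := Harnack (fun w => alpha + kappa * F (z * w))
    (fun w => kappa * (z * C_derive F (z * w))) R0 t Ht HR).
  cbv beta in T.
  rewrite !re_plus, !re_mult, K1, re_RtoC, Cmult_0_r, F0 in T.
  rewrite ?im_RtoC, ?re_RtoC, (Cmult_comm z) in T.
  replace ((1 - t) / (1 + t) * alpha)%R
    with ((1 - t) / (1 + t) * (alpha + (0 * 0 - Im kappa * 0)))%R by ring.
  replace (alpha - Im kappa * Im (F (RtoC t * z)%C))%R with
   (alpha + (0 * Re (F (RtoC t * z)%C) - Im kappa * Im (F (RtoC t * z)%C)))%R by ring.
  apply T.
  - intros w Hw. eapply is_Cderive_eq.
    + apply (is_Cderive_plus (fun _ => RtoC alpha) (fun w => kappa * F (z * w))); [apply is_Cderive_const|].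
      apply is_Cderive_scal. apply (is_Cderive_comp F (fun w => z * w)).
      * apply analytic_is_Cderive; auto.
      * apply is_Cderive_scal, is_Cderive_id.
    + cbv beta. ring.
  - intros w Hw. eexists. do 2 apply is_Cderive_scal.
    apply (is_Cderive_comp (C_derive F) (fun w => z * w)).
    + apply analytic_is_Cderive; [apply analytic_derive, HF|auto].
    + apply is_Cderive_scal, is_Cderive_id.
  - intros w Hw. cbv beta. rewrite re_plus, re_mult, K1, re_RtoC.
    specialize (Hb _ (Hin w Hw)).
    assert (M := Rle_abs (Im kappa * Im (F (z * w)%C))). rewrite Rabs_mult, K2 in M. lra. }
assert (K1 := K Ci eq_refl ltac:(simpl; apply Rabs_R1)).
assert (K2 := K (- Ci) ltac:(simpl; ring) ltac:(simpl; rewrite Rabs_Ropp; apply Rabs_R1)).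
rewrite im_opp in K2. simpl in K1, K2.
assert (E : ((1 - t) / (1 + t) * alpha = alpha - 2 * alpha * t / (1 + t))%R) by (field; lra).
rewrite E in *. apply Rabs_le. lra.
Qed.

(** The bound 3/4 suits PI / 2 > 3/2. From e^x > 1 + x at x = 3/32 one gets e^(3/4) >= (35/32)^8,
    about 2.05; four factors at x = 3/16 would fall just short of 2. *)
Lemma ln_2_lt : (ln 2 < 3 / 4)%R.
Proof.
apply exp_lt_inv. rewrite exp_ln by lra.
assert (E : (exp (3 / 4) = exp (3 / 32) ^ 8)%R).
{ simpl. rewrite Rmult_1_r, <- !exp_plus. f_equal; field. }
rewrite E.
assert (B := exp_ineq1 (3 / 32) ltac:(lra)).
apply Rlt_le_trans with ((1 + 3 / 32) ^ 8)%R; [simpl; lra|].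
apply pow_incr; lra.
Qed.

(* [2 ln 2] is the integral over [0, 1] of the bound [2 / (1 + t)] on [Im (d/dt L(t z)) / alpha]. *)
Lemma Im_primitive_bound (q L : C -> C) (alpha : R) : (0 < alpha)%R -> analytic q -> L 0 = 0 ->
  (forall z, unit_disc z -> is_Cderive L z (q z)) ->
  (forall z, unit_disc z -> (Rabs (Im (z * q z)%C) < alpha)%R) ->
  forall z, unit_disc z -> (Rabs (Im (L z)) < alpha * (PI / 2))%R.
Proof.
intros Ha Hq L0 HL Hb z Hz.
assert (B : forall t, (0 <= t < 1)%R ->
  (Rabs (Im (RtoC t * z * q (RtoC t * z))%C) <= 2 * alpha * t / (1 + t))%R).
{ intros t Ht. apply (Im_bound_ray (fun z => z * q z)); auto.
  - apply analytic_mult; [apply analytic_id|exact Hq].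
  - ring. }
set (lam := fun t => Im (L (RtoC t * z)%C)).
assert (Dl : forall t, (0 <= t <= 1)%R -> derivable_pt_lim lam t (Im (q (RtoC t * z) * z)%C)).
{ intros t Ht. apply is_derive_Reals. apply path_derive_im, path_derive_along_ray, HL.
  apply unit_disc_ray; auto. }
assert (Dln : forall t, (0 <= t <= 1)%R -> derivable_pt_lim (fun t => 2 * alpha * ln (1 + t))%R t (2 * alpha / (1 + t))%R).
{ intros t Ht. apply is_derive_Reals. auto_derive; [lra|]. field; lra. }
(* Here the factor t of Harnack's bound is divided out, hence t > 0. *)
assert (Q : forall t, (0 < t < 1)%R -> (Rabs (Im (q (RtoC t * z) * z)%C) <= 2 * alpha / (1 + t))%R).
{ intros t Ht. specialize (B t ltac:(lra)).
  replace (RtoC t * z * q (RtoC t * z)%C) with (RtoC t * (q (RtoC t * z)%C * z)) in B by ring.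
  rewrite im_scal_l, Rabs_mult, (Rabs_right t) in B by lra.
  apply (Rmult_le_reg_l t); [lra|]. eapply Rle_trans; [exact B|]. right; field; lra. }
(* Instead of integrating, the functions lam -+ 2 alpha ln (1 + t) are compared at 0 and 1; their
   derivatives have constant sign by [Q] at the interior points [c1] and [c2]. Strictness comes from
   [ln_2_lt]. *)
destruct (MVT_cor2 (fun t => lam t - 2 * alpha * ln (1 + t))%R
   (fun t => Im (q (RtoC t * z) * z)%C - 2 * alpha / (1 + t))%R 0 1 ltac:(lra)) as [c1 [C1 I1]].
{ intros t Ht. apply derivable_pt_lim_minus; auto. }
destruct (MVT_cor2 (fun t => lam t + 2 * alpha * ln (1 + t))%R
   (fun t => Im (q (RtoC t * z) * z)%C + 2 * alpha / (1 + t))%R 0 1 ltac:(lra)) as [c2 [C2 I2]].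
{ intros t Ht. apply derivable_pt_lim_plus; auto. }
assert (l0 : lam 0%R = 0%R) by (unfold lam; rewrite Cmult_0_l, L0; reflexivity).
assert (l1 : lam 1%R = Im (L z)) by (unfold lam; rewrite Cmult_1_l; reflexivity).
rewrite l0, l1, Rplus_0_r, ln_1 in C1, C2.
replace (1 + 1)%R with 2%R in * by ring.
assert (Q1 := Q c1 I1). assert (Q2 := Q c2 I2).
apply Rabs_le_between in Q1, Q2.
assert (N := ln_2_lt). assert (PI32 := PI2_3_2). unfold PI2 in *.
apply Rabs_def1; nra.
Qed.

Lemma subordinate_strip (p L : C -> C) (alpha : R) : (0 < alpha)%R -> analytic L -> L 0 = 0 ->
  (forall z, unit_disc z -> p z = Cexp (L z)) ->
  (forall z, unit_disc z -> (Rabs (Im (L z)) < alpha * (PI / 2))%R) ->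
  subordinate p (fun z => Cpower ((1 + z) / (1 - z)) alpha).
Proof.
intros Ha HL L0 HpL Hb.
assert (Na : RtoC alpha <> 0) by (apply RtoC_neq_0; lra).
set (e := fun z => Cexp (/ alpha * L z)).
assert (He : analytic e).
{ intros z Hz. eexists. apply (is_Cderive_comp Cexp (fun z => / alpha * L z)).
  - apply is_Cderive_Cexp.
  - apply is_Cderive_scal, analytic_is_Cderive; auto. }
assert (Im_e : forall z, unit_disc z -> (Rabs (Im (/ alpha * L z)%C) < PI / 2)%R).
{ intros z Hz. specialize (Hb z Hz). rewrite <- RtoC_inv, im_scal_l by lra.
  rewrite Rabs_mult, (Rabs_right (/ alpha)) by (apply Rle_ge, Rlt_le, Rinv_0_lt_compat, Ha).
  apply (Rmult_lt_reg_l alpha); auto. rewrite <- Rmult_assoc, Rinv_r, Rmult_1_l by lra. exact Hb. }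
assert (Re_e : forall z, unit_disc z -> (0 < Re (e z))%R).
{ intros z Hz. specialize (Im_e z Hz). apply Rabs_def2 in Im_e.
  change (0 < exp (Re (/ alpha * L z)%C) * cos (Im (/ alpha * L z)%C))%R. apply Rmult_lt_0_compat; [apply exp_pos|].
  apply cos_gt_0; lra. }
assert (Ne : forall z, unit_disc z -> e z + 1 <> 0).
{ intros z Hz E. specialize (Re_e z Hz). apply (f_equal Re) in E.
  rewrite re_plus, !re_RtoC in E. lra. }
(* Cayley transform: it maps the right half-plane onto the disc and 1 to 0. Its inverse is (1 + w) /
   (1 - w), which recovers [e], and [Clog_Cexp] then turns the principal power into Cexp (L z). *)
exists (fun z => (e z + - (1)) / (e z + 1)).
split; [|split; [|split]].
- apply (analytic_div (fun z => e z + - (1)) (fun z => e z + 1)); auto;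
    (apply analytic_plus; [exact He|intros z _; eexists; apply is_Cderive_const]).
- intros z Hz. unfold unit_disc. rewrite Cmod_div by auto.
  assert (P : (0 < Cmod (e z + 1))%R) by (apply Cmod_gt_0; auto).
  apply Rlt_div_l; [exact P|]. rewrite Rmult_1_l.
  unfold Cmod. apply sqrt_lt_1_alt. specialize (Re_e z Hz). revert Re_e.
  destruct (e z) as [x y]. simpl. intros Re_e. 
  generalize (Rle_0_sqr (x - 1)) (Rle_0_sqr y). unfold Rsqr. lra.
- unfold e. rewrite L0, Cmult_0_r, Cexp_0.
  replace (1 + - (1)) with (RtoC 0) by ring. unfold Cdiv. ring.
- intros z Hz. rewrite HpL by exact Hz.
  replace ((1 + (e z + - (1)) / (e z + 1)) / (1 - (e z + - (1)) / (e z + 1))) with (e z).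
  + unfold Cpower, e. rewrite Clog_Cexp.
    * f_equal. field. exact Na.
    * specialize (Im_e z Hz). generalize PI_RGT_0. lra.
  + field. split; [auto|].
    (* This denominator comes from 1 - w = 2 / (e z + 1). *)
    match goal with |- ?a <> _ => replace a with (RtoC 2) by ring end.
    apply RtoC_neq_0; lra.
Qed.

(** Evaluates [quot] at 0: there the raw quotient agrees with a differentiable function only off the
    point. *)
Lemma C_lim_of_derivable (F p : C -> C) (z l : C) (r : R) : (0 < r)%R ->
  is_Cderive p z l -> (forall y, y <> z -> (Cmod (y - z) < r)%R -> F y = p y) -> C_lim F z = p z.
Proof.
intros r0 Hp E. apply is_C_lim_unique.
apply filterlim_locally. intros eps.
destruct (is_Cderive_continuous p z l Hp eps (cond_pos eps)) as [d [d0 Hd]].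
assert (m0 : (0 < Rmin d r / 2)%R) by (assert (0 < Rmin d r)%R by (apply Rmin_case; auto); lra).
exists (mkposreal _ m0). intros y Hy Hyz.
assert (Hm : (Cmod (y - z) < Rmin d r)%R) by (apply ball_C_Cmod; [lra|exact Hy]).
rewrite E; [|exact Hyz|eapply Rlt_le_trans; [exact Hm|apply Rmin_r]].
apply C_NormedModule_mixin_compat1.
exact (Hd y (Rlt_le_trans _ _ _ Hm (Rmin_l _ _))).
Qed.

(** * Application to the product [f g] *)

Theorem corollary2p12 (alpha : R) (halpha0 : (0 < alpha)%R) (halpha1 : (alpha <= 1)%R)
  (f g : C -> C) (hf : class_A f) (hg : class_H11 g)
  (hf0 : forall z : C, unit_disc z -> z <> 0 -> f z <> 0)
  (hg0 : forall z : C, unit_disc z -> g z <> 0)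
  (hfg0 : forall z : C, unit_disc z -> C_derive f z * g z + C_derive g z * f z <> 0)
  (hIm : forall z : C, unit_disc z ->
     (Rabs (Im (1 + quot (fun x => x * C_derive (C_derive f) x * g x
                                   + 2 * x * C_derive f x * C_derive g x
                                   + x * C_derive (C_derive g) x * f x)
                         (fun x => C_derive f x * g x + C_derive g x * f x) z
                - (zlogder f z + zlogder g z))%C) < alpha)%R) :
  strongly_starlike alpha (fun z => f z * g z).
Proof.
destruct hf as [Hf [f00 f10]]. destruct hg as [Hg g00].
destruct (analytic_factor_id f Hf f00) as [k [Hk [k00 Hfk]]]. rewrite f10 in k00.
assert (Hf1 := analytic_derive f Hf). assert (Hg1 := analytic_derive g Hg).
assert (Hk0 : forall z, unit_disc z -> k z <> 0).
{ intros z Hz E. destruct (Ceq_dec z 0) as [->|N].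
  - rewrite k00 in E. apply RtoC_inj in E. lra.
  - apply (hf0 z Hz N). rewrite Hfk, E by exact Hz. ring. }
set (dh := fun z => C_derive f z * g z + C_derive g z * f z).
assert (Hdh : analytic dh) by (apply analytic_plus; apply analytic_mult; auto).
assert (Dfg : forall z, unit_disc z -> is_Cderive (fun z => f z * g z) z (dh z)).
{ intros z Hz. eapply is_Cderive_eq.
  - apply is_Cderive_mult; apply analytic_is_Cderive; eassumption.
  - unfold dh. ring. }
set (m := fun z => k z * g z).
assert (Hm : analytic m) by (apply analytic_mult; auto).
assert (Hm0 : forall z, unit_disc z -> m z <> 0) by (intros z Hz; apply Cmult_neq_0; auto).
set (p := fun z => dh z / m z).
assert (Hp : analytic p) by (apply analytic_div; auto).
assert (Hp0 : forall z, unit_disc z -> p z <> 0).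
{ intros z Hz E. apply (hfg0 z Hz). change (dh z = 0).
  replace (dh z) with (p z * m z) by (unfold p; field; auto). rewrite E. ring. }
assert (p00 : p 0 = 1).
{ unfold p, dh, m. rewrite f00, f10, g00, k00. field. }
assert (zp : forall z, unit_disc z -> zlogder (fun z => f z * g z) z = p z).
{ intros z Hz. unfold zlogder, quot.
  assert (E : forall y, unit_disc y -> y <> 0 ->
    y * C_derive (fun z => f z * g z) y / (f y * g y) = p y).
  { intros y Hy N. rewrite (is_Cderive_unique _ _ _ (Dfg y Hy)).
    unfold p, m. rewrite (Hfk y Hy) at 1. field. auto. }
  destruct (Ceq_dec z 0) as [->|N]; [|apply E; auto].
  apply (C_lim_of_derivable _ p 0 (C_derive p 0) 1); [lra|apply analytic_is_Cderive; auto|].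
  intros y Ny Hy. apply E; auto. unfold unit_disc. replace (y - 0) with y in Hy by ring. exact Hy. }
destruct (analytic_log p Hp Hp0 p00) as [L [L0 [DL pL]]].
assert (HL : analytic L) by (intros z Hz; eexists; apply DL, Hz).
assert (Hq : analytic (fun z => C_derive p z / p z)).
{ apply analytic_div; auto. apply analytic_derive, Hp. }
assert (HF : forall z, unit_disc z -> (Rabs (Im (z * (C_derive p z / p z))%C) < alpha)%R).
(* At the origin the factor z reduces the claim to 0 < alpha. *)
{ intros z Hz. destruct (Ceq_dec z 0) as [->|N].
  { rewrite Cmult_0_l. simpl. rewrite Rabs_R0. exact halpha0. }
  (* With p = dh / m, z p'/p is z dh'/dh - z m'/m. Off 0, m = f g / z, so z m'/m = z f'/f + z g'/g -
     1; this is the origin of the [1 +] in the hypothesis. *)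
  replace (z * (C_derive p z / p z)) with
   (1 + quot (fun x => x * C_derive (C_derive f) x * g x
                       + 2 * x * C_derive f x * C_derive g x
                       + x * C_derive (C_derive g) x * f x)
             (fun x => C_derive f x * g x + C_derive g x * f x) z
      - (zlogder f z + zlogder g z)); [apply hIm, Hz|].
  assert (D1 : is_Cderive dh z (C_derive (C_derive f) z * g z + C_derive f z * C_derive g z +
     (C_derive (C_derive g) z * f z + C_derive g z * C_derive f z))).
  { apply (is_Cderive_plus (fun z => C_derive f z * g z) (fun z => C_derive g z * f z));
      apply is_Cderive_mult; apply analytic_is_Cderive; auto. }
  assert (D2 : is_Cderive m z (C_derive k z * g z + k z * C_derive g z)).
  { apply is_Cderive_mult; apply analytic_is_Cderive; auto. }
  assert (D3 : C_derive f z = k z + z * C_derive k z).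
  { apply is_Cderive_unique.
    apply (is_Cderive_ext_ball (fun z => z * k z) f z _ (1 - Cmod z)).
    - unfold unit_disc in Hz; lra.
    - intros y Hy. symmetry. apply Hfk, (in_unit_disc_ball z), Hy.
    - eapply is_Cderive_eq.
      + apply (is_Cderive_mult (fun z => z)); [apply is_Cderive_id|apply analytic_is_Cderive; eassumption].
      + cbv beta; ring. }
  rewrite (is_Cderive_unique p z _ (is_Cderive_div dh m z _ _ D1 D2 (Hm0 z Hz))).
  unfold zlogder, quot. destruct (Ceq_dec z 0) as [E|_]; [elim (N E)|].
  unfold p, dh, m. assert (N1 := hfg0 z Hz). assert (N2 := Hk0 z Hz). assert (N3 := hg0 z Hz).
  rewrite (Hfk z Hz) in *.
  (* Eliminating k' leaves a rational identity in z, k, g and the derivatives of f and g. *)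
  replace (C_derive k z) with ((C_derive f z - k z) / z) by (rewrite D3; field; exact N).
  field. repeat split; auto. }
assert (B := Im_primitive_bound _ L alpha halpha0 Hq L0 DL HF).
destruct (subordinate_strip p L alpha halpha0 HL L0 pL B) as [w [W1 [W2 [W3 W4]]]].
split; [|split].
- split; [apply analytic_mult; auto|split].
  + rewrite f00. ring.
  + rewrite (is_Cderive_unique _ _ _ (Dfg 0 unit_disc_0)). unfold dh. rewrite f00, f10, g00. ring.
- intros z Hz N. apply Cmult_neq_0; auto.
- exists w. repeat split; auto. intros z Hz. rewrite zp; auto.
Qed.
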